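(* Let $X$ be an L-embedded Banach space with L-projection $P : X^{**} \to X^{**}$ (so $P$ has range $X$). Then $P$ is weak$^*$-weakly sequentially continuous: whenever $(x_n^{**})_{n\in\mathbb{N}}$ is a sequence in $X^{**}$ which converges to $x^{**}\in X^{**}$ in the weak$^*$ topology $\sigma(X^{**},X^* )$, the sequence $(Px_n^{**})$ converges to $Px^{**}$ in the weak topology $\sigma(X,X^* )$ of $X$.
   Context: Banach spaces are real or complex. A Banach space $X$ is identified with its canonical image in its bidual $X^{**}$. $X$ is called L-embedded (or an L-summand in its bidual) if there is a linear projection $P$ on $X^{**}$ with range $X$ such that $\|Px^{**}\| + \|x^{**}-Px^{**}\| = \|x^{**}\|$ for all $x^{**}\in X^{**}$. Such a $P$ is called the L-projection of $X$. *)

(* Defs.v *)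
From HB Require Import structures.
From mathcomp Require Import all_boot all_order all_algebra.
From mathcomp Require Import complex.
From mathcomp Require Import all_classical all_reals all_analysis.

Set Implicit Arguments.
Unset Strict Implicit.
Unset Printing Implicit Defensive.

Import Order.TTheory GRing.Theory Num.Theory.
Import numFieldNormedType.Exports.

Local Open Scope classical_set_scope.
Local Open Scope ring_scope.

Inductive scalar_kind := RealScalars | ComplexScalars.

Definition scalars (R : realType) (k : scalar_kind) : numFieldType :=
  match k with RealScalars => R | ComplexScalars => R[i] end.

(* Norms of a normed module over K take their values in K itself. The maps
   of_real and re_part translate between real numbers and elements of K. *)
Definition of_real (R : realType) (k : scalar_kind) : R -> scalars R k :=
  match k with
  | RealScalars => fun r => r
  | ComplexScalars => fun r => r%:C%C
  end.

Definition re_part (R : realType) (k : scalar_kind) : scalars R k -> R :=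
  match k with
  | RealScalars => fun c => c
  | ComplexScalars => fun c => complex.Re c
  end.

Section scalars_theory.
Context {R : realType} {k : scalar_kind}.
Implicit Types (r s : R) (c d : scalars R k).

Lemma re_partK c : 0 <= c -> of_real k (re_part c) = c.
Proof.
case: k c => //= -[a b]; rewrite lecE/= => /andP[/eqP b0 _].
by rewrite b0.
Qed.

Lemma of_real_le r s : (of_real k r <= of_real k s) = (r <= s).
Proof. by case: k => //=; rewrite lecR. Qed.

End scalars_theory.

Section topdual.
Context {R : realType} {k : scalar_kind} (E : normedModType (scalars R k)).
Local Notation K := (scalars R k).

Definition is_topdual : {pred E -> K^o} :=
  [pred f : E -> K^o | `[< linear f /\ continuous f >] ].

Record topdual := TopDual {
  topdual_fun :> E -> K^o ;
  topdual_valP : topdual_fun \in is_topdual }.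

HB.instance Definition _ := [isSub for topdual_fun].
HB.instance Definition _ := [Choice of topdual by <:].

Lemma topdualP (f : topdual) : linear f /\ continuous f.
Proof. exact/asboolP/topdual_valP. Qed.

Lemma topdual_ext (f g : topdual) : f =1 g -> f = g.
Proof. by move=> fg; apply/val_inj/funext. Qed.

Fact is_topdual_submod_closed : submod_closed is_topdual.
Proof.
split.
  apply/asboolP; split; last exact: cst_continuous.
  by move=> a x y /=; rewrite scaler0 addr0.
move=> a f g /asboolP[lf cf] /asboolP[lg cg].
apply/asboolP; split.
  move=> b x y; rewrite !fctE lf lg !scalerDr !scalerA (mulrC b).
  by rewrite addrACA.
move=> x; apply: cvgD; last exact: cg.
by apply: cvgZl_tmp; exact: cf.
Qed.

HB.instance Definition _ :=
  GRing.isSubmodClosed.Build K (E -> K^o) is_topdual is_topdual_submod_closed.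
HB.instance Definition _ := [SubChoice_isSubLmodule of topdual by <:].

HB.instance Definition _ (f : topdual) :=
  GRing.isLinear.Build K E K^o *:%R f (topdualP f).1.

Lemma topdual0E x : (0 : topdual) x = 0. Proof. by []. Qed.

Lemma topdualDE (f g : topdual) x : (f + g) x = f x + g x. Proof. by []. Qed.

Lemma topdualZE a (f : topdual) x : (a *: f) x = a * f x. Proof. by []. Qed.

Definition topdual_norm (f : topdual) : K :=
  of_real k (sup [set re_part `|f x| | x in [set x | `|x| <= 1]]).

Let image_neq0 (f : topdual) :
  [set re_part `|f x| | x in [set x | `|x| <= 1]] !=set0.
Proof. by exists (re_part `|f 0|); exists 0 => //=; rewrite normr0. Qed.

Lemma topdual_bounded (f : topdual) :
  exists2 M : K, 0 <= M & forall x, `|f x| <= M * `|x|.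
Proof.
have /linear_bounded_continuous/linear_boundedP : continuous f.
  exact: (topdualP f).2.
by move=> /pinfty_ex_gt0[M /ltW M0 fM]; exists M.
Qed.

Let image_has_sup (f : topdual) :
  has_sup [set re_part `|f x| | x in [set x | `|x| <= 1]].
Proof.
split; first exact: image_neq0.
have [M M0 fM] := topdual_bounded f.
exists (re_part M) => _ [x /= x1 <-].
rewrite -(of_real_le (k := k)) !re_partK//.
by rewrite (le_trans (fM x))// ler_piMr.
Qed.

Lemma topdual_norm_ub (f : topdual) x : `|x| <= 1 -> `|f x| <= topdual_norm f.
Proof.
move=> x1; rewrite -[leLHS]re_partK// of_real_le.
by apply: sup_upper_bound; [exact: image_has_sup|exists x].
Qed.

Lemma topdual_norm_lub (f : topdual) c :
  (forall x, `|x| <= 1 -> `|f x| <= c) -> topdual_norm f <= c.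
Proof.
move=> fc; have c0 : 0 <= c by rewrite (le_trans _ (fc 0 _)) ?normr0.
rewrite -(re_partK c0) of_real_le; apply: ge_sup; first exact: image_neq0.
by move=> _ [x /= x1 <-]; rewrite -(of_real_le (k := k)) !re_partK// fc.
Qed.

Lemma topdual_norm_ge0 f : 0 <= topdual_norm f.
Proof. by rewrite (le_trans _ (@topdual_norm_ub f 0 _)) ?normr0. Qed.

Lemma le_topdual_norm (f : topdual) x : `|f x| <= topdual_norm f * `|x|.
Proof.
have [->|x0] := eqVneq x 0; first by rewrite linear0 !normr0 mulr0.
have nx : 0 < `|x| by rewrite normr_gt0.
have := @topdual_norm_ub f (`|x|^-1 *: x).
rewrite normrZ normfV normr_id mulVf ?gt_eqF// => /(_ (lexx _)).
by rewrite linearZ normrM normfV normr_id mulrC ler_pdivrMr.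
Qed.

Fact ler_topdual_normD f g :
  topdual_norm (f + g) <= topdual_norm f + topdual_norm g.
Proof.
apply: topdual_norm_lub => x x1; rewrite topdualDE.
by rewrite (le_trans (ler_normD _ _))// lerD// topdual_norm_ub.
Qed.

Fact topdual_normZ a f : topdual_norm (a *: f) = `|a| * topdual_norm f.
Proof.
have le b g : topdual_norm (b *: g) <= `|b| * topdual_norm g.
  apply: topdual_norm_lub => x x1.
  by rewrite topdualZE normrM ler_wpM2l// topdual_norm_ub.
apply/eqP; rewrite eq_le le/=.
have [->|a0] := eqVneq a 0; first by rewrite normr0 mul0r topdual_norm_ge0.
rewrite mulrC -ler_pdivlMr ?normr_gt0// mulrC -normfV.
by rewrite (le_trans _ (le _ _))// scalerA mulVf// scale1r.
Qed.

Fact topdual_norm0_eq0 f : topdual_norm f = 0 -> f = 0.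
Proof.
move=> f0; apply: topdual_ext => x; apply/eqP.
by rewrite topdual0E -normr_le0 (le_trans (le_topdual_norm f x))// f0 mul0r.
Qed.

HB.instance Definition _ := Lmodule_isNormed.Build K topdual
  ler_topdual_normD topdual_normZ topdual_norm0_eq0.

End topdual.

Lemma initial_ptws_cvgP (S : choiceType) (T : topologicalType) (U : uniformType)
    (g : S -> {ptws T -> U}) (u : nat -> S) (x : S) :
  u @ \oo --> (x : initial_topology g) <->
  forall t, (fun n => g (u n) t) @ \oo --> g x t.
Proof.
split=> [ux t|ux].
  suff /pointwise_cvgP : {ptws, (g \o u) @ \oo --> g x} by exact.
  by apply: cvg_comp ux _; exact: initial_continuous.
have gux : {ptws, (g \o u) @ \oo --> g x} by apply/pointwise_cvgP.
move=> A; rewrite /= nbhsE => -[_ [[C oC <-] Cx] CA].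
have /gux : nbhs (g x) C by exact: open_nbhs_nbhs.
by apply: (@filterS _ \oo) => n Cn; exact: CA.
Qed.

Notation bidual E := (topdual (topdual E)).

Section canonical_embedding.
Context {R : realType} {k : scalar_kind} (E : normedModType (scalars R k)).

Fact evaluation_subproof (x : E) :
  (fun f : topdual E => f x) \in @is_topdual R k (topdual E).
Proof.
apply/asboolP; split; first by [].
have lin : linear (fun f : topdual E => f x : (scalars R k)^o) by [].
pose ev := HB.pack_for {linear topdual E -> (scalars R k)^o}
  (fun f : topdual E => f x : (scalars R k)^o)
  (GRing.isLinear.Build _ _ _ _ _ lin).
apply: (@bounded_linear_continuous _ _ _ ev); apply/linear_boundedP.
near=> r => f; rewrite (le_trans (le_topdual_norm f x))// mulrC.
by rewrite ler_wpM2r ?topdual_norm_ge0.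
Unshelve. all: by end_near. Qed.

Definition to_bidual (x : E) : bidual E := TopDual (evaluation_subproof x).

(* sigma(E, E^* ): the coarsest topology on E for which all the functionals in
   the dual of E are continuous. *)
Definition weak : Type :=
  initial_topology
    (fun x : E => (fun f => f x) : {ptws topdual E -> scalars R k}).

(* sigma(E^*, E): the coarsest topology on the dual of E for which the
   evaluations at all the points of E are continuous. *)
Definition weak_star : Type :=
  initial_topology
    (fun f : topdual E => (fun x => f x) : {ptws E -> scalars R k}).

HB.instance Definition _ := Topological.on weak.
HB.instance Definition _ := Topological.on weak_star.

Lemma weak_cvgP (u : nat -> weak) (x : weak) :
  u @ \oo --> x <-> forall f : topdual E, (fun n => f (u n)) @ \oo --> f x.
Proof. exact: initial_ptws_cvgP. Qed.

Lemma weak_star_cvgP (u : nat -> weak_star) (f : weak_star) :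
  u @ \oo --> f <->
  forall x : E, (fun n => (u n : topdual E) x) @ \oo --> (f : topdual E) x.
Proof. exact: initial_ptws_cvgP. Qed.

End canonical_embedding.

Section L_projection.
Context {R : realType} {k : scalar_kind} (X : normedModType (scalars R k)).

Definition is_L_projection (P : {linear bidual X -> bidual X}) : Prop :=
  [/\ forall phi, P (P phi) = P phi,
      range P = range (@to_bidual R k X) &
      forall phi, `|P phi| + `|phi - P phi| = `|phi| ].

Definition weak_star_weak_seq_continuous (p : bidual X -> X) : Prop :=
  forall (u : nat -> bidual X) (phi : bidual X),
    u @ \oo --> (phi : weak_star (topdual X)) ->
    (fun n => p (u n)) @ \oo --> (p phi : weak X).

End L_projection.

(* Main.v *)
(* The range of the projection P plays no role beyond the definition of p: for
   every dual space Z and every L-projection P on its dual Z', if psi_n tends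
   to 0 pointwise on Z then so does P psi_n. Suppose not. Hahn-Banach applied to
   the seminorm p(z) = limsup |P psi_n(z)| yields F in Z' with |F| <= p and
   F(z0) = p(z0) > 0. For Q = P or Q = I - P, also F - Q F does not vanish at
   z0, and |Q psi_n(z)| > c infinitely often as soon as c < |F(z)|. Since Z'' is
   the l^oo-sum of the kernels of the adjoints Q* and (I - Q)*, passing from
   y in Z to the pair Q* y, (I - Q)* y does not increase the norms of signed
   sums; a Goldstine-Helly argument replaces this pair by elements u, y - u of Z
   with prescribed approximate values at psi_n, F and F - Q F. Starting from z0
   and iterating on y - u produces u_0, u_1, ... in Z whose signed sums are
   bounded, and n_0 < n_1 < ... with |psi_{n_k}(u_k)| > e. As Z is a dual space,
   the sums of the u_i over arbitrary sets of indices exist in the weak* sense,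
   so this contradicts Phillips' lemma. *)

Require Import Defs.
From HB Require Import structures.
From mathcomp Require Import all_boot all_order all_algebra.
From mathcomp Require Import complex ring lra.
From mathcomp Require Import all_classical all_reals all_analysis.

Import Order.TTheory GRing.Theory Num.Theory.
Import numFieldNormedType.Exports.

Local Open Scope classical_set_scope.
Local Open Scope ring_scope.

Set Implicit Arguments.
Unset Strict Implicit.
Unset Printing Implicit Defensive.

(** * Real-valued norms *)

Section real_norm.
Context {R : realType} {k : scalar_kind}.
Local Notation K := (scalars R k).
Local Notation "r %:K" := (of_real k r) (at level 2, format "r %:K").

(** The norm as an element of [R], so that suprema and linear arithmetic apply uniformly to real and
    complex scalars. *)
Definition nrm {V : normedZmodType K} (x : V) : R := re_part `|x|.

Lemma of_realK : cancel (of_real k) (@re_part R k).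
Proof. by case: k. Qed.

Lemma of_realD (r s : R) : (r + s)%:K = r%:K + s%:K.
Proof. by case: k => //=; rewrite rmorphD. Qed.

Lemma of_realM (r s : R) : (r * s)%:K = r%:K * s%:K.
Proof. by case: k => //=; rewrite rmorphM. Qed.

Lemma of_realN (r : R) : (- r)%:K = - r%:K.
Proof. by case: k => //=; rewrite rmorphN. Qed.

Lemma of_real0 : (0 : R)%:K = 0.
Proof. by case: k. Qed.

Lemma of_real1 : (1 : R)%:K = 1.
Proof. by case: k. Qed.

Lemma of_realV (r : R) : (r^-1)%:K = r%:K^-1.
Proof. by case: k => //=; rewrite fmorphV. Qed.

Lemma of_real_lt (r s : R) : (r%:K < s%:K) = (r < s).
Proof. by case: k => //=; rewrite ltcR. Qed.

Lemma of_real_ge0 (r : R) : (0 <= r%:K) = (0 <= r).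
Proof. by rewrite -of_real0 of_real_le. Qed.

Lemma of_real_gt0 (r : R) : (0 < r%:K) = (0 < r).
Proof. by rewrite -of_real0 of_real_lt. Qed.

Lemma re_partD (c d : K) : re_part (c + d) = re_part c + re_part d.
Proof. by case: k c d => //= -[a b] [c d]. Qed.

Lemma re_partMr (r : R) (c : K) : re_part (r%:K * c) = r * re_part c.
Proof. by case: k c => //= -[a b] /=; rewrite mul0r subr0. Qed.

Lemma of_real_nrm (V : normedZmodType K) (x : V) : (nrm x)%:K = `|x|.
Proof. exact: re_partK. Qed.

Lemma nrm_ge0 (V : normedZmodType K) (x : V) : 0 <= nrm x.
Proof. by rewrite -of_real_ge0 of_real_nrm. Qed.

Lemma nrmD (V : normedZmodType K) (x y : V) : nrm (x + y) <= nrm x + nrm y.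
Proof. by rewrite -(of_real_le (k := k)) of_realD !of_real_nrm ler_normD. Qed.

Lemma nrmN (V : normedZmodType K) (x : V) : nrm (- x) = nrm x.
Proof. by rewrite /nrm normrN. Qed.

Lemma nrm0 (V : normedZmodType K) : nrm (0 : V) = 0.
Proof. by rewrite /nrm normr0 -of_real0 of_realK. Qed.

Lemma nrmB (V : normedZmodType K) (x y : V) : nrm (x - y) = nrm (y - x).
Proof. by rewrite -nrmN opprB. Qed.

Lemma nrmZ (V : normedModType K) (a : K) (x : V) : nrm (a *: x) = nrm a * nrm x.
Proof.
by apply: (can_inj of_realK); rewrite of_realM !of_real_nrm normrZ.
Qed.

Lemma nrmM (a b : K) : nrm (a * b) = nrm a * nrm b.
Proof.
by apply: (can_inj of_realK); rewrite of_realM !of_real_nrm normrM.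
Qed.

Lemma nrmV (a : K) : nrm a^-1 = (nrm a)^-1.
Proof.
by apply: (can_inj of_realK); rewrite of_realV !of_real_nrm normfV.
Qed.

Lemma nrm1 : nrm (1 : K) = 1.
Proof. by rewrite /nrm normr1 -of_real1 of_realK. Qed.

Lemma nrm_of_real (r : R) : nrm r%:K = `|r|.
Proof.
rewrite /nrm; case: k => //=.
by rewrite expr0n addr0 sqrtr_sqr.
Qed.

Lemma nrm_eq0 (V : normedModType K) (x : V) : (nrm x == 0) = (x == 0).
Proof.
rewrite -(inj_eq (can_inj of_realK)) of_real_nrm of_real0.
exact: normr_eq0.
Qed.

Lemma nrm_sum (V : normedModType K) (I : Type) (s : seq I) (F : I -> V) :
  nrm (\sum_(i <- s) F i) <= \sum_(i <- s) nrm (F i).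
Proof.
elim/big_rec2: _ => [|i y x _ xy]; first by rewrite nrm0.
by rewrite (le_trans (nrmD _ _))// lerD2l.
Qed.

Lemma ler_nrmB (V : normedModType K) (x y : V) : nrm x - nrm y <= nrm (x - y).
Proof. by rewrite lerBlDr (le_trans _ (nrmD _ _))// subrK. Qed.

Lemma re_part_le (c : K) : re_part c <= nrm c.
Proof.
rewrite /nrm; case: k c => //= [c|[a b]]; first exact: ler_norm.
rewrite (le_trans (ler_norm _))// -sqrtr_sqr.
by rewrite ler_wsqrtr// lerDl sqr_ge0.
Qed.

Lemma phase (c : K) : exists2 e : K, nrm e = 1 & e * c = (nrm c)%:K.
Proof.
have [->|c0] := eqVneq c 0.
  by exists 1; rewrite ?nrm1// mulr0 nrm0 of_real0.
exists (`|c| / c); last by rewrite of_real_nrm mulfVK.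
have n0 : nrm c != 0.
  by rewrite -(inj_eq (can_inj of_realK)) of_real_nrm of_real0 normr_eq0.
by rewrite nrmM nrmV {1}/nrm normr_id -/(nrm c) divff.
Qed.

(** * Functionals and the real-valued dual norm *)

Section dual.
Context (E : normedModType K).

Lemma nrm_app (f : topdual E) x : nrm (f x) <= nrm f * nrm x.
Proof.
by rewrite -(of_real_le (k := k)) of_realM !of_real_nrm; exact: le_topdual_norm.
Qed.

Lemma nrm_lub (f : topdual E) (c : R) :
  (forall x, nrm x <= 1 -> nrm (f x) <= c) -> nrm f <= c.
Proof.
move=> fc; rewrite -(of_real_le (k := k)) of_real_nrm.
apply: topdual_norm_lub => x x1.
rewrite -[leLHS]of_real_nrm of_real_le; apply: fc.
by rewrite -(of_real_le (k := k)) of_real_nrm of_real1.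
Qed.

Lemma nrm_le_bound (f : topdual E) (c : R) : 0 <= c ->
  (forall x, nrm (f x) <= c * nrm x) -> nrm f <= c.
Proof.
by move=> c0 fc; apply: nrm_lub => x x1; rewrite (le_trans (fc x))// ler_piMr.
Qed.

Lemma nrm_adherent (f : topdual E) (c : R) : c < nrm f ->
  exists2 x, nrm x <= 1 & c < nrm (f x).
Proof.
move=> cf; apply: contrapT => h; move: cf; apply/negP; rewrite -leNgt.
apply: nrm_lub => x x1; rewrite leNgt; apply/negP => cfx.
by apply: h; exists x.
Qed.

Lemma bounded_topdual (f : E -> K^o) (c : R) : linear f ->
  (forall x, nrm (f x) <= c * nrm x) -> exists g : topdual E, g =1 f.
Proof.
move=> lf fc.
suff ft : f \in @is_topdual R k E by exists (TopDual ft).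
apply/asboolP; split => //.
pose g := HB.pack_for {linear E -> K^o} f
  (GRing.isLinear.Build _ _ _ _ _ lf).
apply: (@bounded_linear_continuous _ _ _ g); apply/linear_boundedP.
have c'0 : 0 <= Num.max c 0 by rewrite le_max lexx orbT.
exists (Num.max c 0)%:K; split; first by rewrite ger0_real// of_real_ge0.
move=> r cr x; rewrite (@le_trans _ _ ((Num.max c 0)%:K * `|x|))//.
  rewrite -of_real_nrm -[`|x|]of_real_nrm -of_realM of_real_le (le_trans (fc x))//.
  by rewrite ler_wpM2r ?nrm_ge0// le_max lexx.
by rewrite ler_wpM2r// ltW.
Qed.

End dual.

End real_norm.

(** * The Hahn-Banach theorem *)

(** Shared by three pointwise infima: [drop], the infimum of a chain and [inf_seminorm]. The
    minorant [l] makes the infima finite. *)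
Lemma inf_fun_subadditive (R : realType) (V : zmodType) (S : V -> set R)
    (l : V -> R) :
  (forall v, S v !=set0) -> (forall v c, S v c -> l v <= c) ->
  (forall u v c d, S u c -> S v d -> S (u + v) (c + d)) ->
  forall u v, inf (S (u + v)) <= inf (S u) + inf (S v).
Proof.
move=> S0 lS SD u v.
have lbS w : has_lbound (S w) by exists (l w) => c; exact: lS.
have ninf w : has_inf (S w) by split.
apply/ler_addgt0Pr => e e0; have e20 : 0 < e / 2 by rewrite divr_gt0.
have [c Sc clt] := inf_adherent e20 (ninf u).
have [d Sd dlt] := inf_adherent e20 (ninf v).
have := ge_inf (lbS (u + v)) (SD _ _ _ _ Sc Sd); lra.
Qed.

Lemma inf_fun_scale (R : realType) (V : Type) (S : V -> set R)
    (l : V -> R) (u v : V) (r : R) : 0 < r ->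
  (forall v, S v !=set0) -> (forall v c, S v c -> l v <= c) ->
  (forall c, S v c -> S u (r * c)) ->
  inf (S u) <= r * inf (S v).
Proof.
move=> r0 S0 lS SZ.
rewrite mulrC -ler_pdivrMr//; apply: lb_le_inf => [|c Sc]; first exact: S0.
rewrite ler_pdivrMr// mulrC; apply: ge_inf; last exact: SZ.
by exists (l u) => d; exact: lS.
Qed.

Section hahn_banach.
Context {R : realType} {k : scalar_kind} (V : lmodType (scalars R k)).
Local Notation K := (scalars R k).
Local Notation "r %:K" := (of_real k r) (at level 2, format "r %:K").

(** An inequality is enough for homogeneity: applied to [r^-1] it gives the reverse one. *)
Definition sublinear (q : V -> R) :=
  (forall u v, q (u + v) <= q u + q v) /\
  (forall (r : R) v, 0 < r -> q (r%:K *: v) <= r * q v).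

Definition seminorm (p : V -> R) :=
  (forall u v, p (u + v) <= p u + p v) /\
  (forall (a : K) v, p (a *: v) <= nrm a * p v).

Lemma sublinear0 q : sublinear q -> q 0 = 0.
Proof.
move=> [_ qZ]; have := qZ 2 0; have := qZ 2^-1 0.
rewrite !scaler0 invr_gt0 ltr0n => /(_ isT) ? /(_ isT); lra.
Qed.

Lemma sublinear_ge q v : sublinear q -> - q (- v) <= q v.
Proof.
move=> sq; have := sq.1 v (- v); rewrite subrr sublinear0//; lra.
Qed.

Lemma seminorm_sublinear p : seminorm p -> sublinear p.
Proof.
move=> [pD pZ]; split=> // r v r0.
by rewrite (le_trans (pZ _ _))// nrm_of_real gtr0_norm.
Qed.

Lemma seminorm_ge0 p v : seminorm p -> 0 <= p v.
Proof.
move=> sp; have /sublinear_ge := seminorm_sublinear sp => /(_ v).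
by have := sp.2 (-1) v; rewrite scaleN1r nrmN nrm1 mul1r; lra.
Qed.

(* [inf (drop q u v)] is the largest sublinear functional below [q] whose
   value at [- u] is at most [- q u]. *)
Let drop (q : V -> R) (u v : V) : set R :=
  [set c | exists2 t : R, 0 <= t & q (v + t%:K *: u) - t * q u <= c].

(** Subadditivity gives [q (v + t u) + q (- v) >= q (t u) >= t * q u], so the bound does not depend
    on [t]. *)
Let drop_lb q u v c : sublinear q -> drop q u v c -> - q (- v) <= c.
Proof.
move=> sq [t /= t0]; apply: le_trans.
have [->|tn0] := eqVneq t 0.
  by rewrite of_real0 scale0r addr0 mul0r subr0 sublinear_ge.
have {tn0}t0 : 0 < t by rewrite lt_neqAle eq_sym tn0.
have := sq.1 (v + t%:K *: u) (- v); rewrite addrAC subrr add0r.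
have := sq.2 t u t0.
have := sq.2 t^-1 (t%:K *: u); rewrite invr_gt0 => /(_ t0).
rewrite scalerA of_realV mulVf ?scale1r; last first.
  by rewrite -of_real0 (inj_eq (can_inj (@of_realK R k))) gt_eqF.
by rewrite mulrC ler_pdivlMr// mulrC; lra.
Qed.

Let drop_neq0 q u v : drop q u v !=set0.
Proof. by eexists; exists 0. Qed.

Let drop_sublinear q u : sublinear q -> sublinear (fun v => inf (drop q u v)).
Proof.
move=> sq; split=> [|r v r0].
  apply: (@inf_fun_subadditive _ _ (drop q u) (fun v => - q (- v))) => //.
    by move=> ? ?; exact: drop_lb.
  move=> v w c d [s s0 sc] [t t0 td]; exists (s + t); first exact: addr_ge0.
  have := sq.1 (v + s%:K *: u) (w + t%:K *: u).
  by rewrite addrACA -scalerDl -of_realD; lra.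
apply: (@inf_fun_scale _ _ (drop q u) (fun v => - q (- v))) => //.
  by move=> ? ?; exact: drop_lb.
move=> c [t t0 tc]; exists (r * t); first by rewrite mulr_ge0// ltW.
have := sq.2 r (v + t%:K *: u) r0.
rewrite scalerDr scalerA -of_realM; move/le_trans => h.
rewrite -mulrA lerBlDr; apply: h; rewrite -mulrDr; apply: ler_wpM2l; first exact: ltW.
by rewrite -lerBlDr.
Qed.

Let drop_le q u v : sublinear q -> inf (drop q u v) <= q v.
Proof.
move=> sq; apply: ge_inf; first by exists (- q (- v)) => c; exact: drop_lb.
by exists 0 => //; rewrite of_real0 scale0r addr0 mul0r subr0.
Qed.

Let drop_opp q u : sublinear q -> inf (drop q u (- u)) <= - q u.
Proof.
move=> sq; apply: ge_inf.
  by exists (- q (- - u)) => c; exact: drop_lb.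
exists 1; first exact: ler01.
by rewrite of_real1 scale1r addNr sublinear0// mul1r sub0r.
Qed.

(** Zorn's lemma for the reversed pointwise order. A nonempty chain is bounded by its pointwise
    infimum, which is finite since [t v >= - p (- v)] for every sublinear [t] below [p]. *)
Let minimal_sublinear (p : V -> R) : sublinear p ->
  exists q, [/\ sublinear q, forall v, q v <= p v &
    forall r, sublinear r -> (forall v, r v <= q v) -> r = q].
Proof.
move=> sp; pose T := {q : V -> R | sublinear q /\ forall v, q v <= p v}.
pose below (s t : T) : bool := `[< forall v, sval t v <= sval s v >].
have [||||[q [sq qp]] qmin] := @Zorn T below.
- by move=> t; apply/asboolP.
- move=> r s t /asboolP rs /asboolP st; apply/asboolP => v.
  exact: le_trans (st v) (rs v).
- move=> [s ?] [t ?] /asboolP /= st /asboolP /= ts; apply: eq_exist.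
  by apply/funext => v; apply/eqP; rewrite eq_le st ts.
- move=> A totA; have [[a Aa]|A0] := pselect (A !=set0); last first.
    exists (exist _ p (conj sp (fun v => lexx _))) => s As.
    by exfalso; apply: A0; exists s.
  pose S v := [set c | exists2 t, A t & sval t v <= c].
  have lS v c : S v c -> - p (- v) <= c.
    case=> -[t [st tp]] /= At; apply: le_trans.
    by apply: le_trans (sublinear_ge v st); rewrite lerN2.
  have S0 v : S v !=set0 by exists (sval a v); exists a.
  have sS : sublinear (fun v => inf (S v)).
    split=> [|r v r0].
      apply: (@inf_fun_subadditive _ _ S _ S0 lS).
      move=> v w c d [s As sc] [t At td].
      have [/asboolP st|/asboolP ts] := totA _ _ As At.
        exists t => //; have := (svalP t).1.1 v w.
        by have := st v; lra.
      exists s => //; have := (svalP s).1.1 v w.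
      by have := ts w; lra.
    apply: (@inf_fun_scale _ _ S _ _ _ _ r0 S0 lS).
    move=> c [t At tc]; exists t => //.
    by rewrite (le_trans ((svalP t).1.2 _ _ r0))// ler_wpM2l// ltW.
  have infS v t : A t -> inf (S v) <= sval t v.
    move=> At; apply: ge_inf; last by exists t.
    by exists (- p (- v)) => c; exact: lS.
  have Sp v : inf (S v) <= p v by rewrite (le_trans (infS v _ Aa))// (svalP a).2.
  exists (exist _ (fun v => inf (S v)) (conj sS Sp)) => s As.
  by apply/asboolP => v; exact: infS.
exists q; split=> // r sr rq.
have rp v : r v <= p v by rewrite (le_trans (rq v)).
suff /(congr1 sval) : exist _ r (conj sr rp) =
  exist (fun q => sublinear q /\ forall v, q v <= p v) q (conj sq qp) by [].
by apply: qmin; exact/asboolP.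
Qed.

(* A minimal sublinear functional [q] is odd, since otherwise
   [inf (drop q u _)] would be smaller for some [u]. *)
Lemma sublinear_dominated (p : V -> R) (v0 : V) : sublinear p ->
  exists g : V -> R, [/\ {morph g : u v / u + v},
    forall (r : R) v, g (r%:K *: v) = r * g v, forall v, g v <= p v & g v0 = p v0].
Proof.
(* Starting below [inf (drop p v0 _)] instead of [p] forces [q (- v0) <= - p v0], hence
   [q v0 = p v0] once [q] is known to be odd. *)
move=> sp; have [q [sq qp qmin]] := minimal_sublinear (drop_sublinear v0 sp).
have qN u : q (- u) = - q u.
  have E := qmin _ (drop_sublinear u sq) (fun v => drop_le u v sq).
  apply/eqP; rewrite eq_le; apply/andP; split.
    by rewrite -{1}E; exact: drop_opp.
  by have := sublinear_ge (- u) sq; rewrite opprK.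
have qZ r v : 0 < r -> q (r%:K *: v) = r * q v.
  move=> r0; apply/eqP; rewrite eq_le sq.2//=.
  by have := sq.2 r (- v) r0; rewrite scalerN !qN mulrN lerN2.
exists q; split=> [u v|r v|v|].
- apply/eqP; rewrite eq_le sq.1/=.
  by have := sq.1 (- u) (- v); rewrite -opprD !qN; lra.
- have [r0|r0|->] := ltgtP r 0.
  + have := qZ (- r) v; rewrite oppr_gt0 => /(_ r0).
    by rewrite of_realN scaleNr qN mulNr => /oppr_inj.
  + exact: qZ.
  + by rewrite of_real0 scale0r mul0r sublinear0.
- by rewrite (le_trans (qp v))// drop_le.
- apply/eqP; rewrite eq_le (le_trans (qp v0)) ?drop_le//=.
  by have := le_trans (qp (- v0)) (drop_opp v0 sp); rewrite qN lerN2.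
Qed.

(** A complex functional is determined by its real part: [f v = g v - i g (i v)]. *)
Lemma complexify (g : V -> R) : {morph g : u v / u + v} ->
  (forall (r : R) v, g (r%:K *: v) = r * g v) ->
  exists2 f : V -> K^o, linear f & forall v, re_part (f v) = g v.
Proof.
move: g; case: k V => [] W g gD gZ.
  by exists g => // a u v; rewrite gD gZ.
exists (fun v => (g v -i* g ('i%C *: v))%C) => // a u v.
have gZ' b w : g (b *: w) = complex.Re b * g w + complex.Im b * g ('i%C *: w).
  case: b => c d; have -> : (c +i* d)%C = c%:C%C + d%:C%C * 'i%C.
    by apply/eqP; rewrite eq_complex /= !(mul0r, mulr0, mulr1, add0r, addr0, subr0) !eqxx.
  by rewrite scalerDl gD -scalerA !gZ /=; ring.
case: a => c d; apply/eqP; rewrite eq_complex; apply/andP; split; apply/eqP => /=.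
  by rewrite gD gZ' /=; ring.
by rewrite scalerDr scalerA gD gZ' /=; ring.
Qed.

Lemma eq_of_real_re (c : K) : nrm c <= re_part c -> c = (re_part c)%:K.
Proof.
case: k c => // -[a b]; rewrite /nrm /= => h.
have a0 : 0 <= a by rewrite (le_trans _ h)// sqrtr_ge0.
have : a ^+ 2 + b ^+ 2 <= a ^+ 2.
  rewrite -[leLHS]sqr_sqrtr ?addr_ge0 ?sqr_ge0//.
  by rewrite ler_sqr ?nnegrE ?sqrtr_ge0.
rewrite gerDl => b0; have /eqP -> : b == 0; last by [].
by rewrite -sqrf_eq0 eq_le b0 sqr_ge0.
Qed.

Lemma linear_functional_morph (W : lmodType K) (f : W -> K^o) : linear f ->
  [/\ f 0 = 0, {morph f : u v / u + v}, {morph f : u v / u - v} &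
      forall a v, f (a *: v) = a * f v].
Proof.
move=> lf; pose g := HB.pack_for {linear W -> K^o} f
  (GRing.isLinear.Build _ _ _ _ _ lf).
split; [exact: (linear0 g)|exact: (linearD g)|exact: (linearB g)|].
by move=> a v; exact: (linearZ_LR g).
Qed.

(** Rotating [v] by the phase of [f v] turns the bound on the real part into one on the modulus. At
    [v0] the modulus is then at most the real part [p v0], so the value is real. *)
Theorem hahn_banach (p : V -> R) (v0 : V) : seminorm p ->
  exists f : V -> K^o,
    [/\ linear f, forall v, nrm (f v) <= p v & f v0 = (p v0)%:K].
Proof.
move=> sp; have [g [gD gZ gp gv0]] := sublinear_dominated v0 (seminorm_sublinear sp).
have [f lf fg] := complexify gD gZ.
have fp v : nrm (f v) <= p v.
  have [e e1 ef] := phase (f v : K).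
  have [_ _ _ fZ] := linear_functional_morph lf.
  have := gp (e *: v); rewrite -fg fZ ef of_realK => /le_trans; apply.
  by rewrite (le_trans (sp.2 _ _))// e1 mul1r.
exists f; split=> //.
have := @eq_of_real_re (f v0); rewrite fg gv0; apply; exact: fp.
Qed.

End hahn_banach.

(** * A Goldstine-Helly theorem for finitely many seminorms *)

Section helly.
Context {R : realType} {k : scalar_kind} (Z : normedModType (scalars R k)).
Local Notation K := (scalars R k).
Local Notation "r %:K" := (of_real k r) (at level 2, format "r %:K").

Lemma linear_functional_sum (V : lmodType K) (f : V -> K^o) (I : finType)
    (F : I -> V) : linear f -> f (\sum_i F i) = \sum_i f (F i).
Proof.
move=> /linear_functional_morph[f0 fD _ _].
by elim/big_rec2: _ => // i y x _ <-.
Qed.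

Lemma inf_seminorm (V : lmodType K) (S : V -> set R) :
  (forall v, S v !=set0) -> (forall v c, S v c -> 0 <= c) ->
  S 0 0 ->
  (forall u v c d, S u c -> S v d -> S (u + v) (c + d)) ->
  (forall a v c, S v c -> S (a *: v) (nrm a * c)) ->
  seminorm (fun v => inf (S v)).
Proof.
move=> S0 Sge0 S00 SD SZ; split.
  exact: (@inf_fun_subadditive _ _ S (fun=> 0)).
move=> a v; have [->|a0] := eqVneq a 0.
  rewrite scale0r nrm0 mul0r; apply: ge_inf => //.
  by exists 0 => c; exact: Sge0.
apply: (@inf_fun_scale _ _ S (fun=> 0)) => //; last by move=> c; exact: SZ.
by rewrite lt_neqAle nrm_ge0 andbT eq_sym (@nrm_eq0 _ _ K^o).
Qed.

Lemma seminorm_nrm : seminorm (@nrm R k Z).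
Proof. by split=> [u v|a v]; [exact: nrmD|rewrite nrmZ]. Qed.

Lemma seminorm0 (V : lmodType K) (p : V -> R) : seminorm p -> p 0 = 0.
Proof. by move=> /seminorm_sublinear/sublinear0. Qed.

(** Apply Hahn-Banach at [b] to the distance from the diagonal in the product of copies of [Z],
    measured by the maximum of the [p i]. The functional splits into [g i] with sum 0 whose
    [p i]-norms sum to at most 1. As [G] vanishes on the sum of the [g i], the hypothesis bounds the
    distance by [C]. *)
Theorem helly (I : finType) (p : I -> Z -> R) (M C : R) (b : I -> Z)
    (G : topdual Z -> K^o) :
  (forall i, seminorm (p i)) -> (forall i z, p i z <= M * nrm z) ->
  linear G -> 0 <= C ->
  (forall i (g : topdual Z) t, 0 <= t ->
    (forall z, nrm (g z) <= t * p i z) -> nrm (g (b i) - G g) <= C * t) ->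
  forall e, 0 < e -> exists w, forall i, p i (b i - w) <= C + e.
Proof.
move=> sp pM lG C0 HG e e0.
have [G0 _ _ _] := linear_functional_morph lG.
pose V := {ffun I -> Z}.
(* The clause [0 <= c] keeps [S v] bounded below even when [I] is empty. *)
pose S (v : V) : set R :=
  [set c | 0 <= c /\ exists w, forall i, p i (v i - w) <= c].
have pge0 i z : 0 <= p i z by exact: seminorm_ge0 (sp i).
have Sdiag z : S [ffun=> z] 0.
  by split=> //; exists z => i; rewrite ffunE subrr seminorm0.
have SSn v : S v !=set0.
  exists (\sum_i p i (v i)); split; first by rewrite sumr_ge0.
  exists 0 => i; rewrite subr0 (bigD1 i)//= lerDl sumr_ge0// => j _; exact: pge0.
have S_lb v : has_lbound (S v) by exists 0 => c [].
have sq : seminorm (fun v => inf (S v)).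
  apply: inf_seminorm => //.
  - by move=> v c [].
  - have <- : [ffun=> 0] = 0 :> V by apply/ffunP => i; rewrite !ffunE.
    exact: Sdiag.
  - move=> u v c d [c0 [x xc]] [d0 [y yd]]; split; first exact: addr_ge0.
    exists (x + y) => i; rewrite ffunE opprD addrACA.
    by rewrite (le_trans ((sp i).1 _ _))// lerD.
  - move=> a v c [c0 [x xc]]; split; first by rewrite mulr_ge0 ?nrm_ge0.
    exists (a *: x) => i; rewrite ffunE -scalerBr (le_trans ((sp i).2 _ _))//.
    by rewrite ler_wpM2l// nrm_ge0.
pose B : V := [ffun i => b i].
have [f [lf fq fB]] := hahn_banach B sq.
have [f0 fD _ fZ] := linear_functional_morph lf.
have q_le v c : S v c -> inf (S v) <= c by exact: ge_inf.
pose single i z : V := [ffun j => if j == i then z else 0].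
have fsingle i : exists g : topdual Z, g =1 (f \o single i).
  apply: (@bounded_topdual _ _ _ (f \o single i) M) => [a u v|z] /=.
    have -> : single i (a *: u + v) = a *: single i u + single i v.
      by apply/ffunP => j; rewrite !ffunE; case: ifP => //; rewrite scaler0 addr0.
    exact: lf.
  rewrite (le_trans (fq _))// (le_trans _ (pM i z))// q_le//; split=> //.
  exists 0 => j; rewrite subr0 ffunE; case: eqP => [->//|_].
  by rewrite seminorm0.
have [g gf] := choice fsingle.
have fsum v : f v = \sum_i g i (v i).
  have {1}-> : v = \sum_i single i (v i).
    apply/ffunP => j; rewrite sum_ffunE (bigD1 j)//= !ffunE eqxx big1 ?addr0// => i ij.
    by rewrite ffunE eq_sym (negbTE ij).
  by rewrite linear_functional_sum//; apply: eq_bigr => i _; rewrite gf.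
have gp i z : nrm (g i z) <= p i z.
  rewrite gf /= (le_trans (fq _))// q_le//; split=> //.
  exists 0 => j; rewrite subr0 ffunE; case: eqP => [->//|_].
  by rewrite seminorm0.
(* The seminorm, and so [f], vanishes on the diagonal. *)
have sumg : \sum_i g i = 0.
  apply: topdual_ext => z.
  have -> : (\sum_i g i) z = \sum_i g i z by elim/big_rec2: _ => // i y x _ <-.
  have := fq [ffun=> z]; rewrite fsum.
  under eq_bigr do rewrite ffunE.
  move=> /le_trans/(_ (q_le _ _ (Sdiag z))) h.
  by apply/eqP; rewrite -nrm_eq0 eq_le h nrm_ge0.
(* [sup (T i)] is the norm of [g i] dual to the seminorm [p i]. *)
pose T i := [set nrm (g i z) | z in [set z | p i z <= 1]].
have hsT i : has_sup (T i).
  split; first by exists (nrm (g i 0)), 0 => //=; rewrite seminorm0.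
  by exists 1 => _ [z /= z1 <-]; exact: le_trans (gp i z) z1.
have supT0 i : 0 <= sup (T i).
  rewrite -(@nrm0 R k K^o) -(linear0 (g i)); apply: sup_upper_bound => //.
  by exists 0 => //=; rewrite seminorm0.
have gT i z : nrm (g i z) <= sup (T i) * p i z.
  have [pz|pz] := eqVneq (p i z) 0.
    by rewrite pz mulr0 -pz.
  have pz0 : 0 < p i z by rewrite lt_neqAle eq_sym pz pge0.
  rewrite -ler_pdivrMr//; apply: sup_upper_bound => //.
  exists (((p i z)^-1)%:K *: z) => /=.
    rewrite (le_trans ((sp i).2 _ _))// nrm_of_real gtr0_norm ?invr_gt0//.
    by rewrite mulVf.
  by rewrite linearZ nrmZ nrm_of_real gtr0_norm ?invr_gt0// mulrC.
(* Nearly extremal [z i], rotated to make all [g i (z i)] nonnegative, form one vector [v] at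
   distance at most 1 from the diagonal. *)
have sumT : \sum_i sup (T i) <= 1.
  apply/ler_addgt0Pr => d d0; pose d' := d / #|I|.+1%:R.
  have d'0 : 0 < d' by rewrite divr_gt0// ltr0n.
  have /choice[z zP] i : exists z, p i z <= 1 /\ sup (T i) - d' < nrm (g i z).
    by have [_ [z z1 <-] h] := sup_adherent d'0 (hsT i); exists z.
  have /choice[c cP] i : exists c : K, nrm c = 1 /\ c * g i (z i) = (nrm (g i (z i)))%:K.
    by have [c c1 ce] := phase (g i (z i)); exists c.
  pose v : V := [ffun i => c i *: z i].
  have fv : f v = (\sum_i nrm (g i (z i)))%:K.
    rewrite fsum (big_morph (of_real k) (@of_realD R k) (@of_real0 R k)).
    by apply: eq_bigr => i _; rewrite ffunE linearZ -(cP i).2.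
  have : nrm (f v) <= 1.
    rewrite (le_trans (fq _))// q_le//; split=> //; exists 0 => i.
    rewrite subr0 ffunE (le_trans ((sp i).2 _ _))// (cP i).1 mul1r.
    exact: (zP i).1.
  rewrite fv nrm_of_real ger0_norm ?sumr_ge0// => [h|i _]; last exact: nrm_ge0.
  have : \sum_i sup (T i) <= \sum_i (nrm (g i (z i)) + d').
    by apply: ler_sum => i _; rewrite -lerBlDr ltW// (zP i).2.
  rewrite big_split/= sumr_const => /le_trans; apply.
  rewrite lerD// -mulr_natr mulrAC ler_pdivrMr ?ltr0n//.
  by rewrite ler_pM2l// ler_nat.
have qC : inf (S B) <= C.
  have -> : inf (S B) = nrm (f B).
    by rewrite fB nrm_of_real ger0_norm// (seminorm_ge0 _ sq).
  have -> : f B = \sum_i (g i (b i) - G (g i)).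
    rewrite fsum sumrB -linear_functional_sum// sumg G0 subr0.
    by apply: eq_bigr => i _; rewrite ffunE.
  rewrite (le_trans (nrm_sum _ _))//.
  rewrite (@le_trans _ _ (\sum_i C * sup (T i)))//.
    by apply: ler_sum => i _; exact: HG.
  by rewrite -mulr_sumr ler_piMr.
have [c [_ [w wc]]] := inf_adherent e0 (conj (SSn B) (S_lb B)).
move=> clt; exists w => i; have := wc i; rewrite ffunE => /le_trans; apply.
by rewrite (le_trans (ltW clt))// lerD2r.
Qed.

End helly.

(** * L-projections of a dual space *)

Section L_structure.
Context {R : realType} {k : scalar_kind} (Z : normedModType (scalars R k)).
Local Notation K := (scalars R k).
Local Notation "r %:K" := (of_real k r) (at level 2, format "r %:K").

(** [Q] is a bare function, so that [I - Q] is an object of the same kind. *)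
Definition L_proj (Q : topdual Z -> topdual Z) :=
  [/\ linear Q, forall phi, Q (Q phi) = Q phi &
      forall phi, nrm (Q phi) + nrm (phi - Q phi) = nrm phi].

Lemma L_proj_compl Q : L_proj Q -> L_proj (fun phi => phi - Q phi).
Proof.
move=> [lQ QQ nQ]; split=> [a f g|f|f].
- by rewrite lQ scalerBr opprD addrACA.
- have QB g h : Q (g - h) = Q g - Q h.
    have := lQ (-1) h g; rewrite !scaleN1r => e.
    by rewrite addrC e addrC.
  by rewrite QB QQ subrr subr0.
- by rewrite subKr addrC nQ.
Qed.

Lemma topdualBE (f g : topdual Z) z : (f - g) z = f z - g z.
Proof. by []. Qed.

Lemma topdualDr (f : topdual Z) y z : f (y + z) = f y + f z.
Proof. exact: (linearD f). Qed.

Lemma topdualBr (f : topdual Z) y z : f (y - z) = f y - f z.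
Proof. exact: (linearB f). Qed.

Lemma topdualZr (f : topdual Z) (a : K) z : f (a *: z) = a * f z.
Proof. exact: (linearZ_LR f). Qed.

Lemma topdual_prescribed (f : topdual Z) (c : K) : f != 0 -> exists z, f z = c.
Proof.
move=> f0; have [z fz] : exists z, f z != 0.
  apply: contrapT => h; move/eqP: f0; apply; apply: topdual_ext => z.
  by apply/eqP; apply: contrapT => /negP fz; apply: h; exists z.
by exists ((c / f z) *: z); rewrite topdualZr mulfVK.
Qed.

(** [z - f z *: z0] lies in the kernel of [f], hence in that of [g]. This identifies the functionals
    that [helly] tests against a seminorm proportional to [|f z|]. *)
Lemma topdual_dominated (f g : topdual Z) (t : R) : f != 0 ->
  (forall z, nrm (g z) <= t * nrm (f z)) -> exists c : K, g = c *: f.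
Proof.
move=> /topdual_prescribed f0 gf; have [z0 fz0] := f0 1.
exists (g z0); apply: topdual_ext => z; rewrite topdualZE.
have : nrm (g (z - f z *: z0)) <= 0.
  rewrite (le_trans (gf _))// topdualBr topdualZr fz0.
  by rewrite mulr1 subrr nrm0 mulr0.
move=> h; have /eqP : nrm (g (z - f z *: z0)) = 0.
  by apply/eqP; rewrite eq_le h nrm_ge0.
rewrite nrm_eq0 topdualBr topdualZr subr_eq0 => /eqP ->.
by rewrite mulrC.
Qed.

(* For [g] in the dual of [Z], the vectors [b + y] and [b - y] are tested
   against the two components [Q g] and [g - Q g], whose norms add up. *)
Lemma L_proj_reflection_bound Q (g : topdual Z) (b y : Z) (C t : R) : L_proj Q ->
  0 <= C -> nrm g <= t -> nrm (b + y) <= C -> nrm (b - y) <= C ->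
  nrm (g b - (g y - (Q g) y *+ 2)) <= C * t.
Proof.
move=> [_ _ nQ] C0 gt bDy bBy.
have -> : g b - (g y - (Q g) y *+ 2) = (g - Q g) (b - y) + (Q g) (b + y).
  by rewrite topdualBE !topdualBr topdualDr mulr2n; ring.
rewrite (le_trans (nrmD _ _))//.
rewrite (@le_trans _ _ (C * nrm g))//; last by rewrite ler_wpM2l.
rewrite -nQ mulrDr addrC; apply: lerD.
  by rewrite (le_trans (nrm_app _ _))// mulrC ler_wpM2r ?nrm_ge0.
by rewrite (le_trans (nrm_app _ _))// mulrC ler_wpM2r ?nrm_ge0.
Qed.

(** By [L_proj_reflection_bound], the reflection [y - 2 Q^* y] in the bidual of [Z] stays as close
    to every [a i] and [- a i] as [y] and [- y] allow. [helly] replaces it by some [w] in [Z], and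
    the strict inequalities absorb the error. *)
Lemma L_proj_reflection Q (I J : finType) (a : I -> Z) (phi : J -> topdual Z)
    (y : Z) (C d : R) : L_proj Q -> 0 < C -> 0 < d ->
  (forall i, nrm (a i + y) < C) -> (forall i, nrm (a i - y) < C) ->
  exists w, [/\ forall i, nrm (a i + w) < C, forall i, nrm (a i - w) < C &
    forall j, nrm (phi j w - (phi j y - Q (phi j) y *+ 2)) <= d].
Proof.
move=> LQ C0 d0 aDy aBy; have [lQ _ _] := LQ.
pose G (g : topdual Z) : K^o := g y - (Q g) y *+ 2.
(* The gap between the finite maximum [C'] and [C] is the room for the error in [helly]. *)
pose C' := \big[Num.max/0]_i Num.max (nrm (a i + y)) (nrm (a i - y)).
have C'C : C' < C by apply: bigmax_lt => // i _; rewrite gt_max aDy aBy.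
have aC' i : Num.max (nrm (a i + y)) (nrm (a i - y)) <= C' by exact: le_bigmax.
have C'0 : 0 <= C' by exact: bigmax_ge_id.
have lG : linear G.
  move=> c f g; rewrite /G lQ !topdualDE !topdualZE mulrnDl.
  by rewrite /GRing.scale /=; ring.
have /choice[b bP] j : exists b, phi j b - G (phi j) = 0.
  have [->|/topdual_prescribed p0] := eqVneq (phi j) 0.
    exists 0; rewrite linear0 sub0r.
    by have [-> _ _ _] := linear_functional_morph lG; rewrite oppr0.
  by have [b e] := p0 (G (phi j)); exists b; rewrite e subrr.
have Cd : 0 < C / d by rewrite divr_gt0.
(* With the weight [C / d], a bound by [C] on the second kind of seminorm is a bound by [d] on
   [phi j]. *)
pose p (x : I * bool + J) : Z -> R := match x with
  | inl _ => @nrm R k Z | inr j => fun z => (C / d) * nrm (phi j z) end.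
(* The targets [a i] and [- a i] control [a i - w] and [a i + w]; [b j] takes at [phi j] the value
   prescribed by [G]. *)
pose bb (x : I * bool + J) : Z := match x with
  | inl (i, s) => if s then a i else - a i | inr j => b j end.
have sp x : seminorm (p x).
  case: x => [z|j]; first exact: seminorm_nrm.
  split=> [u v|c v] /=.
    by rewrite topdualDr -mulrDr ler_wpM2l ?(ltW Cd)// nrmD.
  by rewrite topdualZr nrmM mulrCA.
pose M := 1 + \sum_j (C / d) * nrm (phi j).
have pM x z : p x z <= M * nrm z.
  have S0 j : 0 <= (C / d) * nrm (phi j) by rewrite mulr_ge0 ?nrm_ge0// ltW.
  case: x => [x|j] /=.
    by rewrite ler_peMl ?nrm_ge0// lerDl sumr_ge0.
  rewrite (@le_trans _ _ ((C / d) * nrm (phi j) * nrm z))//.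
    by rewrite -[leRHS]mulrA ler_wpM2l ?(ltW Cd)// nrm_app.
  rewrite ler_wpM2r ?nrm_ge0// /M (bigD1 j)//= addrCA lerDl addr_ge0//.
  by apply: sumr_ge0.
have e0 : 0 < (C - C') / 2 by rewrite divr_gt0// subr_gt0.
have [|w wP] := helly (b := bb) sp pM lG C'0 _ e0.
  move=> [[i s]|j] g t t0 /= gt.
    have {}gt : nrm g <= t by exact: nrm_le_bound.
    have := aC' i; rewrite ge_max => /andP[h1 h2].
    apply: (L_proj_reflection_bound (Q := Q)) => //; case: s => //.
      by rewrite addrC nrmB.
    by rewrite -opprD nrmN.
  have [pj0|pj0] := eqVneq (phi j) 0.
    have -> : g = 0.
      apply: topdual_ext => z; apply/eqP; rewrite -nrm_eq0 eq_le nrm_ge0 andbT.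
      by rewrite (le_trans (gt z))// pj0 topdual0E nrm0 !mulr0.
    have [-> _ _ _] := linear_functional_morph lG.
    by rewrite topdual0E subrr nrm0 mulr_ge0.
  have [z|c ->] := topdual_dominated (g := g) (t := t * (C / d)) pj0.
    by rewrite -mulrA.
  have [_ _ _ ->] := linear_functional_morph lG.
  by rewrite topdualZE -mulrBr bP mulr0 nrm0 mulr_ge0.
have CC : C' + (C - C') / 2 < C by lra.
exists w; split=> [i|i|j].
- have := wP (inl (i, false)); rewrite /= -opprD nrmN => /le_lt_trans; exact.
- have := wP (inl (i, true)) => /= /le_lt_trans; exact.
- have := le_trans (wP (inr j)) (ltW CC).
  rewrite /= mulrAC ler_pdivrMr// ler_pM2l// topdualBr => h.
  rewrite nrmB (le_trans _ h)// -(subr0 (phi j (b j))) -(bP j).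
  by rewrite opprB addrCA subrr addr0.
Qed.

End L_structure.

(** * Pointwise limits in a dual space *)

Lemma real_abs_summable_cvg (R : realType) (c : nat -> R) (B : R) :
  (forall n, \sum_(i < n) `|c i| <= B) ->
  exists l : R, (fun n => \sum_(i < n) c i) @ \oo --> l.
Proof.
move=> cB; have : cvgn (series c).
  apply: normed_cvg; apply: nondecreasing_is_cvgn.
    by apply: nondecreasing_series => n _ _; exact: normr_ge0.
  by exists B => _ [n _ <-]; rewrite (_ : _ n = \sum_(0 <= i < n) `|c i|)// big_mkord.
move=> /cvg_ex[l cl]; exists l.
rewrite (_ : (fun n => _) = series c)//.
by apply/funext => n; rewrite /series /= big_mkord.
Qed.

Section pointwise_limits.
Context {R : realType} {k : scalar_kind}.
Local Notation K := (scalars R k).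
Local Notation "r %:K" := (of_real k r) (at level 2, format "r %:K").

Lemma cvg_nrmP (s : nat -> K) (l : K) :
  s @ \oo --> l <-> forall e : R, 0 < e -> \forall n \near \oo, nrm (l - s n) < e.
Proof.
split=> [/cvgrPdist_lt sl e e0|sl].
  have /sl : (0 : K) < e%:K by rewrite of_real_gt0.
  apply: filterS => n.
  by rewrite -of_real_nrm of_real_lt.
apply/cvgrPdist_lt => e e0; have /re_partK ee : 0 <= e by exact: ltW.
have /sl : 0 < re_part e by rewrite -(of_real_gt0 (k := k)) ee.
by apply: filterS => n; rewrite -(@of_real_lt R k) ee of_real_nrm.
Qed.

Lemma abs_summable_cvg (c : nat -> K) (B : R) :
  (forall n, \sum_(i < n) nrm (c i) <= B) ->
  exists l : K, (fun n => \sum_(i < n) c i) @ \oo --> l.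
Proof.
move=> cB.
suff [l lP] : exists l : K, forall e : R, 0 < e ->
    \forall n \near \oo, nrm (l - \sum_(i < n) c i) < e.
  by exists l; apply/cvg_nrmP.
case: k c cB => [c cB|c cB].
  have [l /cvgrPdist_lt lP] := real_abs_summable_cvg cB.
  by exists l => e e0; exact: lP.
have re_le (z : R[i]) : `|complex.Re z| <= nrm (k := ComplexScalars) z.
  case: z => a b; rewrite /nrm /= -sqrtr_sqr ler_wsqrtr// lerDl.
  exact: sqr_ge0.
have im_le (z : R[i]) : `|complex.Im z| <= nrm (k := ComplexScalars) z.
  case: z => a b; rewrite /nrm /= -sqrtr_sqr ler_wsqrtr// lerDr.
  exact: sqr_ge0.
have [n|a /cvgrPdist_lt aP] := @real_abs_summable_cvg R (fun i => complex.Re (c i)) B.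
  by apply: le_trans (cB n); apply: ler_sum => i _; exact: re_le.
have [n|b /cvgrPdist_lt bP] := @real_abs_summable_cvg R (fun i => complex.Im (c i)) B.
  by apply: le_trans (cB n); apply: ler_sum => i _; exact: im_le.
exists (a +i* b)%C => e e0.
have e20 : 0 < e / 2 by rewrite divr_gt0.
near=> n.
have -> : (a +i* b)%C - \sum_(i < n) c i =
  of_real ComplexScalars (a - \sum_(i < n) complex.Re (c i)) +
  of_real ComplexScalars (b - \sum_(i < n) complex.Im (c i)) * 'i%C.
  have -> : \sum_(i < n) c i =
      ((\sum_(i < n) complex.Re (c i)) +i* (\sum_(i < n) complex.Im (c i)))%C.
    elim/big_rec3: _ => // i x y z _ ->; case: (c i) => ? ?.
    by [].
  apply/eqP; rewrite eq_complex /=.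
  by rewrite !(mul0r, mulr0, mulr1, add0r, addr0, subr0) !eqxx.
rewrite (le_lt_trans (nrmD _ _))// nrmM !nrm_of_real.
have -> : nrm (k := ComplexScalars) ('i%C : R[i]) = 1.
  by rewrite /nrm /= expr0n add0r expr1n sqrtr1.
rewrite mulr1 [ltRHS]splitr ltrD//; near: n; [exact: aP|exact: bP].
Unshelve. all: by end_near. Qed.

Lemma cvg_nrm_le (s : nat -> K) (l a : K) (c : R) :
  s @ \oo --> l -> (\forall n \near \oo, nrm (s n - a) <= c) -> nrm (l - a) <= c.
Proof.
move=> /cvg_nrmP sl sc; apply/ler_addgt0Pr => e e0.
near \oo => n.
rewrite -(subrKA (s n)) addrC (le_trans (nrmD _ _))// lerD//.
  by near: n.
by apply: ltW; near: n; exact: sl.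
Unshelve. all: by end_near. Qed.

Lemma topdual_pointwise_limit (E : normedModType K) (s : nat -> topdual E)
    (B : R) :
  (forall x, exists l : K, (fun n => s n x) @ \oo --> l) ->
  (forall n x, nrm (s n x) <= B * nrm x) ->
  exists w : topdual E, forall x, (fun n => s n x) @ \oo --> (w x : K).
Proof.
move=> /choice[f fP] sB.
have [|x|w wf] := @bounded_topdual _ _ E f B.
- move=> a x y; apply: (cvg_unique (@norm_hausdorff _ K)) (fP _) _.
  rewrite (_ : (fun n => _) = (fun n => a * s n x + s n y)).
    by apply: cvgD; [apply: cvgM => //; exact: cvg_cst|exact: fP].
  by apply/funext => n; rewrite topdualDr topdualZr.
- rewrite -[f x]subr0; apply: (cvg_nrm_le (fP x)).
  by apply: nearW => n; rewrite subr0.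
- by exists w => x; rewrite wf; exact: fP.
Qed.

Lemma topdual_sumE (E : normedModType K) (I : Type) (r : seq I) (P : pred I)
    (v : I -> topdual E) x :
  (\sum_(i <- r | P i) v i) x = \sum_(i <- r | P i) v i x.
Proof. by elim/big_rec2: _ => // i y z _ <-. Qed.

(** Pointwise absolutely summable series in a dual space have weak* sums; completeness of the
    scalars is all that the limit requires. *)
Lemma topdual_series (E : normedModType K) (v : nat -> topdual E) (B : R) :
  (forall n x, \sum_(i < n) nrm (v i x) <= B * nrm x) ->
  exists w : topdual E,
    forall x, (fun n => \sum_(i < n) v i x) @ \oo --> (w x : K).
Proof.
move=> vB; have [x|n x|w wP] :=
  @topdual_pointwise_limit E (fun n => \sum_(i < n) v i) B.
- have [|l lP] := @abs_summable_cvg (fun i => v i x) (B * nrm x).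
    by move=> n; exact: vB.
  by exists l; under eq_fun do rewrite topdual_sumE.
- rewrite topdual_sumE (le_trans _ (vB n x))//; exact: nrm_sum.
- by exists w => x; have := wP x; under eq_fun do rewrite topdual_sumE.
Qed.

End pointwise_limits.

(** * Uniform boundedness and signed sums *)

Section uniform_boundedness.
Context {R : realType} {k : scalar_kind} (E : normedModType (scalars R k)).
Local Notation K := (scalars R k).
Local Notation "r %:K" := (of_real k r) (at level 2, format "r %:K").

Lemma sum_third n : \sum_(i < n) (3^-1 : R) ^+ i = 3 / 2 * (1 - 3^-1 ^+ n).
Proof.
elim: n => [|n IH]; first by rewrite big_ord0 expr0 subrr mulr0.
by rewrite big_ord_recr /= IH exprS; lra.
Qed.

(* Sokal's gliding hump. *)
Lemma topdual_uniform_boundedness (psi : nat -> bidual E) :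
  (forall z, (fun n => psi n z) @ \oo --> (0 : K)) ->
  exists N (M : R), forall n, (N <= n)%N -> nrm (psi n) <= M.
Proof.
move=> psi0; apply: contrapT => unb.
(* The factor 4 compensates the loss [3/4 - 1/2 = 1/4] in the final estimate. *)
have /choice[m mP] j : exists n, (j <= n)%N /\ 4 * 3 ^+ j < nrm (psi n).
  apply: contrapT => h; apply: unb; exists j, (4 * 3 ^+ j) => n jn.
  by rewrite leNgt; apply/negP => ?; apply: h; exists n.
pose t j : R := 3^-1 ^+ j.
have t0 j : 0 < t j by rewrite exprn_gt0// invr_gt0.
have /choice[D DP] (zj : topdual E * nat) : exists d : topdual E, nrm d <= t zj.2 /\
    3 / 4 * nrm (psi (m zj.2)) * t zj.2 <= nrm (psi (m zj.2) (zj.1 + d)).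
  case: zj => z j /=; set f := psi (m j).
  have f0 : 0 < nrm f.
    by apply: lt_trans (mP j).2; rewrite mulr_gt0// exprn_gt0.
  have [|x x1 xf] := @nrm_adherent _ _ _ f (3 / 4 * nrm f); first by lra.
  pose d := (t j)%:K *: x.
  have dt : nrm d <= t j.
    by rewrite nrmZ nrm_of_real gtr0_norm// ler_piMr// ltW.
  have fd : 3 / 4 * nrm f * t j <= nrm (f d).
    by rewrite topdualZr nrmM nrm_of_real gtr0_norm// mulrC ler_wpM2l ?ltW.
  (* [f (z + d)] and [f (z - d)] differ by [2 f d], so one of them has modulus at least that of
     [f d]. *)
  have [h|h] := leP (3 / 4 * nrm f * t j) (nrm (f (z + d))); first by exists d.
  exists (- d); rewrite nrmN; split=> //.
  have e : f (z + d) - f (z - d) = 2%:K * f d.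
    rewrite topdualBr topdualDr (_ : 2 = 1 + 1 :> R)//.
    by rewrite of_realD of_real1; ring.
  have := nrmD (f (z + d)) (- f (z - d)).
  rewrite e nrmN nrmM nrm_of_real ger0_norm//; lra.
pose zs := fix zs n := if n is n'.+1 then zs n' + D (zs n', n') else 0.
pose d j := D (zs j, j).
have zsE n : zs n = \sum_(i < n) d i.
  by elim: n => [|n IH]; rewrite ?big_ord0// big_ord_recr /= -IH.
have dt j : nrm (d j) <= t j := (DP (zs j, j)).1.
have dx j x : nrm (d j x) <= t j * nrm x.
  by rewrite (le_trans (nrm_app _ _))// ler_wpM2r ?nrm_ge0.
have [|w wP] := @topdual_series _ _ _ d (3 / 2).
  move=> n x; rewrite (@le_trans _ _ (\sum_(i < n) t i * nrm x))//.
    by apply: ler_sum => i _.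
  rewrite -mulr_suml ler_wpM2r ?nrm_ge0// sum_third.
  have : 0 <= 3^-1 ^+ n :> R by rewrite exprn_ge0.
  by lra.
(* The geometric steps after step [j] add up to at most [t j / 2]. *)
have wz j : nrm (w - zs j.+1) <= t j / 2.
  apply: nrm_le_bound => [|x]; first by rewrite divr_ge0// ltW.
  rewrite topdualBE; apply: (cvg_nrm_le (wP x)); near=> n.
  have jn : (j.+1 <= n)%N by near: n; exact: nbhs_infty_ge.
  rewrite zsE topdual_sumE -!(big_mkord xpredT (fun i => d i x)).
  rewrite (big_cat_nat (leq0n _) jn)/= [X in nrm (X - _)]addrC addrK.
  rewrite (le_trans (nrm_sum _ _))//.
  rewrite (@le_trans _ _ (\sum_(j.+1 <= i < n) t i * nrm x))//.
    by apply: ler_sum => i _.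
  rewrite -mulr_suml ler_wpM2r ?nrm_ge0//.
  have -> : \sum_(j.+1 <= i < n) t i = \sum_(i < n) t i - \sum_(i < j.+1) t i.
    rewrite -!(big_mkord xpredT t) (big_cat_nat (leq0n _) jn)//=.
    by rewrite [X in _ = X - _]addrC addrK.
  rewrite !sum_third exprS -/(t j).
  have : 0 <= 3^-1 ^+ n :> R by rewrite exprn_ge0.
  by lra.
(* The modulus of [psi (m j) w] is at least [(3/4 - 1/2) * nrm (psi (m j)) * t j >= 1], although
   these values tend to 0. *)
have /cvg_nrmP/(_ 1 ltr01) := psi0 w.
case=> j _ /(_ (m j) (mP j).1); rewrite sub0r nrmN; apply/negP; rewrite -leNgt.
have := DP (zs j, j); rewrite /= -/(zs j.+1) => -[_ h].
have := ler_nrmB (psi (m j) (zs j.+1)) (psi (m j) (zs j.+1) - psi (m j) w).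
rewrite subKr -topdualBr => h1.
have := nrm_app (psi (m j)) (zs j.+1 - w); rewrite nrmB => h2.
have h3 : nrm (psi (m j)) * nrm (zs j.+1 - w) <= nrm (psi (m j)) * (t j / 2).
  by rewrite ler_wpM2l ?nrm_ge0// nrmB.
have h4 : 4 <= nrm (psi (m j)) * t j.
  rewrite /t exprVn ler_pdivlMr ?exprn_gt0//; exact: ltW (mP j).2.
by rewrite nrmB in h3; lra.
Unshelve. all: by end_near. Qed.

End uniform_boundedness.

Section signed_sums.
Context {R : realType} {k : scalar_kind}.
Local Notation K := (scalars R k).
Local Notation "r %:K" := (of_real k r) (at level 2, format "r %:K").

(** Taking [j = i] for complex and [j = 0] for real scalars lets both cases reduce to real parts. *)
Lemma nrm_le_re2 : exists2 j : K, nrm j <= 1 &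
  forall c : K, nrm c <= `|re_part c| + `|re_part (j * c)|.
Proof.
case: k.
  exists 0 => [|c]; first by rewrite nrm0.
  by rewrite mul0r /= normr0 addr0.
exists 'i%C; first by rewrite /nrm /= expr0n add0r expr1n sqrtr1.
case=> a b; rewrite /nrm /= !mul0r mul1r sub0r normrN.
rewrite -(@ler_pXn2r _ 2) ?nnegrE ?sqrtr_ge0 ?addr_ge0// sqr_sqrtr ?addr_ge0 ?sqr_ge0//.
by rewrite sqrrD !real_normK ?num_real// addrAC lerDl mulrn_wge0// mulr_ge0.
Qed.

(** The signs of the real parts of [g (u i)] turn the sum of their absolute values into the real
    part of [g] at one signed sum. A second pass with [j * g (u i)] accounts for the factor 2. *)
Lemma signed_sums_bound (W : normedModType K) (u : nat -> W) (C : R)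
    (g : topdual W) n :
  (forall s : nat -> bool, nrm (\sum_(i < n) (-1) ^+ s i *: u i) <= C) ->
  \sum_(i < n) nrm (g (u i)) <= 2 * C * nrm g.
Proof.
move=> uC; have [j j1 jP] := nrm_le_re2.
have key (c : K) : nrm c <= 1 ->
    \sum_(i < n) `|re_part (c * g (u i))| <= C * nrm g.
  move=> c1; pose s i := re_part (c * g (u i)) < 0.
  have -> : \sum_(i < n) `|re_part (c * g (u i))| =
      re_part (c * g (\sum_(i < n) (-1) ^+ s i *: u i)).
    have -> : g (\sum_(i < n) (-1) ^+ s i *: u i) = \sum_(i < n) (-1) ^+ s i * g (u i).
      elim/big_rec2: _ => [|i y x _ <-]; first exact: linear0.
      by rewrite topdualDr topdualZr.
    have re0 : re_part (0 : K) = 0 by rewrite -of_real0 of_realK.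
    rewrite mulr_sumr (big_morph (@re_part R k) (@re_partD R k) re0).
    apply: eq_bigr => i _; rewrite normrEsign mulrCA.
    rewrite -/(s i); case: (s i); rewrite ?expr0 ?mul1r// !expr1 !mulN1r.
    by rewrite -[X in _ = re_part X]mulN1r -of_real1 -of_realN re_partMr mulN1r.
  rewrite (le_trans (re_part_le _))// nrmM (le_trans (ler_piMl _ c1)) ?nrm_ge0//.
  by rewrite (le_trans (nrm_app _ _))// mulrC ler_wpM2r ?nrm_ge0.
rewrite (@le_trans _ _ (\sum_(i < n)
  (`|re_part (1 * g (u i))| + `|re_part (j * g (u i))|)))//.
  by apply: ler_sum => i _; rewrite mul1r.
by rewrite big_split /= -mulrA mulrDl mul1r lerD// key// nrm1.
Qed.

End signed_sums.

(** * Phillips' lemma *)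

Section phillips.
Context {R : realType} {k : scalar_kind} (E : normedModType (scalars R k)).
Local Notation K := (scalars R k).
Local Notation "r %:K" := (of_real k r) (at level 2, format "r %:K").

Variables (u : nat -> topdual E) (C : R).
Hypothesis uC : forall n (s : nat -> bool),
  nrm (\sum_(i < n) (-1) ^+ s i *: u i) <= C.

Let C0 : 0 <= C.
Proof. by have := uC 0 xpredT; rewrite big_ord0 nrm0. Qed.

Let uxC n x : \sum_(i < n) nrm (u i x) <= 2 * C * nrm x.
Proof.
have xx : nrm (to_bidual x) <= nrm x.
  apply: nrm_le_bound => [|f]; first exact: nrm_ge0.
  by rewrite mulrC; exact: (nrm_app f x).
have := @signed_sums_bound _ _ _ u C (to_bidual x) n (uC n).
move=> /le_trans; apply; rewrite ler_wpM2l// mulr_ge0//.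
Qed.

Let chi (A : set nat) (i : nat) : K := (`[< A i >])%:R.

Let nrm_chi A i : nrm (chi A i) <= 1.
Proof. by rewrite /chi; case: asbool; rewrite ?nrm1// nrm0. Qed.

(** The weak* sum of the [u i] over [A], later called [U A]. *)
Let subsum_exists (A : set nat) : exists w : topdual E,
  forall x, (fun n => \sum_(i < n) chi A i * u i x) @ \oo --> (w x : K).
Proof.
have [|w wP] := @topdual_series _ _ _ (fun i => chi A i *: u i) (2 * C).
  move=> n x; apply: le_trans (uxC n x); apply: ler_sum => i _.
  by rewrite topdualZE nrmM ler_piMl ?nrm_ge0// nrm_chi.
by exists w.
Qed.

Let U := projT1 (choice subsum_exists).
Let UP A x : (fun n => \sum_(i < n) chi A i * u i x) @ \oo --> (U A x : K).
Proof. exact: (projT2 (choice subsum_exists)). Qed.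

(** The hypothesis says that [A] is the disjoint union of the singleton of [m] and [D]. *)
Let U_split A D m : (forall i, chi A i = (i == m)%:R + chi D i) ->
  U A = u m + U D.
Proof.
move=> AD; apply: topdual_ext => x; rewrite topdualDE.
refine (@cvg_unique K (@norm_hausdorff _ K) _ _ _ _ (@UP A x) _).
have : (fun n => u m x + \sum_(i < n) chi D i * u i x) @ \oo --> (u m x + U D x : K).
  by apply: cvgD (@UP D x); exact: cvg_cst.
apply: cvg_trans; apply: near_eq_cvg; near=> n.
have mn : (m < n)%N by near: n; exact: nbhs_infty_gt.
under [RHS]eq_bigr do rewrite AD mulrDl.
rewrite big_split/=; congr (_ + _).
rewrite (bigD1 (Ordinal mn))//= eqxx mul1r big1 ?addr0// => i im.
by rewrite (_ : (i == m :> nat) = false) ?mul0r//; apply: negbTE.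
Unshelve. all: by end_near. Qed.

(** Each [u i] occurs in at most one [U (B j)], so signed sums of the [U (B j)] are weak* sums with
    coefficients of modulus at most 1, bounded by [2 * C]. *)
Let U_disjoint (g : bidual E) (B : nat -> set nat) r :
  (forall i j j', (j < r)%N -> (j' < r)%N -> B j i -> B j' i -> j = j') ->
  \sum_(j < r) nrm (g (U (B j))) <= 2 * (2 * C) * nrm g.
Proof.
move=> trivB; apply: (@signed_sums_bound _ _ _ (U \o B)) => s /=.
apply: nrm_le_bound => [|x]; first by rewrite mulr_ge0.
rewrite topdual_sumE.
pose S n := \sum_(j < r) ((-1) ^+ s j * \sum_(i < n) chi (B j) i * u i x).
have Scvg : S @ \oo --> (\sum_(j < r) ((-1) ^+ s j * U (B j) x) : K).
  apply: cvg_big => [|j _]; first exact: add_continuous.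
  apply: cvgM; [exact: cvg_cst|exact: UP].
rewrite -[X in nrm X]subr0; apply: (cvg_nrm_le Scvg); apply: nearW => n.
rewrite subr0 /S.
under eq_bigr do rewrite mulr_sumr.
rewrite exchange_big/= (le_trans (nrm_sum _ _))//.
apply: le_trans (uxC n x); apply: ler_sum => i _.
under eq_bigr do rewrite mulrA.
rewrite -mulr_suml nrmM ler_piMl ?nrm_ge0//.
have sgn1 (b : bool) : nrm ((-1) ^+ b : K) <= 1.
  by case: b; rewrite ?expr0 ?expr1 ?nrmN nrm1.
have [[j Bj]|noB] := pselect (exists j : 'I_r, B j i).
  rewrite (bigD1 j)//= big1 ?addr0 => [|j' jj'].
    by rewrite nrmM mulr_ile1 ?nrm_ge0.
  rewrite /chi; case: asboolP => [Bj'|_]; last by rewrite mulr0.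
  by move/eqP: jj'; case; apply: val_inj; apply: trivB Bj' Bj.
rewrite big1 ?nrm0// => j _; rewrite /chi.
by case: asboolP => [Bj|_]; [exfalso; apply: noB; exists j|rewrite mulr0].
Qed.

(* Among [r] disjoint infinite sets of indices, one carries at most a
   fraction [1 / r] of the total variation of [A |-> g (U A)]. *)
Let U_small (g : bidual E) (h : nat -> nat) (p : nat) (d : R) : 0 < d ->
  {homo h : i j / (i < j)%N} ->
  exists h', [/\ {homo h' : i j / (i < j)%N},
    forall i, exists2 j, (p < j)%N & h' i = h j &
    forall B : set nat, B `<=` range h' -> nrm (g (U B)) <= d].
Proof.
move=> d0 hlt; pose D := 2 * (2 * C) * nrm g / d.
have D0 : 0 <= D by rewrite divr_ge0 ?mulr_ge0 ?nrm_ge0// ltW.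
pose r := (Num.truncn D).+1.
(* The enumeration [h] beyond position [p], cut into [r] residue classes; [r > D] makes [r * d]
   exceed the total variation. *)
pose h' j i := h (p.+1 + (i * r + j))%N.
have h'lt j : {homo h' j : i i' / (i < i')%N}.
  by move=> i i' ii'; apply: hlt; rewrite ltn_add2l ltn_add2r ltn_mul2r ii'.
have hinj : injective h.
  by move=> i j hij; case: (ltngtP i j) => // /hlt; rewrite hij ltnn.
apply: contrapT => no.
have /choice[B BP] (j : nat) :
    exists B : set nat, B `<=` range (h' j) /\ d < nrm (g (U B)).
  apply: contrapT => noB; apply: no; exists (h' j); split=> //.
    by move=> i; eexists; last by []; rewrite ltnS leq_addr.
  move=> B Bh'; rewrite leNgt; apply/negP => dB; apply: noB.
  by exists B.
have trivB i j j' : (j < r)%N -> (j' < r)%N -> B j i -> B j' i -> j = j'.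
  move=> jr j'r /(BP j).1[a _ <-] /(BP j').1[b _] /hinj/addnI/(congr1 (modn^~ r)).
  by rewrite !modnMDl !modn_small.
have := U_disjoint g trivB; apply/negP; rewrite -ltNge.
rewrite (@lt_le_trans _ _ (\sum_(j < r) d))//.
  rewrite sumr_const card_ord -[ltRHS]mulr_natr [ltRHS]mulrC -ltr_pdivrMr//.
  exact: truncnS_gt.
by apply: ler_sum => j _; exact: ltW (BP j).2.
Qed.

(** Gliding hump: otherwise indices [m n] are chosen so that [psi (m n)] is small on the sum of the
    earlier [u (m i)] and on every weak* sum over indices still available. On the weak* sum over all
    chosen indices, [psi (m n)] then does not tend to 0. *)
Theorem phillips (psi : nat -> bidual E) (e : R) : 0 < e ->
  (forall z, (fun n => psi n z) @ \oo --> (0 : K)) ->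
  exists n, nrm (psi n (u n)) < e.
Proof.
move=> e0 psi0; apply: contrapT => big.
have {}big n : e <= nrm (psi n (u n)).
  by rewrite leNgt; apply/negP => ?; apply: big; exists n.
have e40 : 0 < e / 4 by rewrite divr_gt0.
pose incr (h : nat -> nat) := {homo h : i j / (i < j)%N}.
(* State: the sum of the chosen [u] and an increasing enumeration of the available indices. [q]
   holds the position of the next choice and a thinner enumeration beyond it. *)
have /choice[next nextP] (s : topdual E * (nat -> nat)) :
    exists q : nat * (nat -> nat), incr s.2 ->
    [/\ incr q.2, forall i, exists2 j, (q.1 < j)%N & q.2 i = s.2 j,
     nrm (psi (s.2 q.1) s.1) <= e / 4 &
     forall B : set nat, B `<=` range q.2 -> nrm (psi (s.2 q.1) (U B)) <= e / 4].
  have [ih|nih] := pselect (incr s.2); last by exists (0%N, id).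
  (* The threshold [p] also serves as position, since [p <= s.2 p] for increasing [s.2]. *)
  have [p _ ps] := (cvg_nrmP _ _).1 (psi0 s.1) _ e40.
  have [h' [h'1 h'2 h'3]] := U_small (psi (s.2 p)) p e40 ih.
  exists (p, h') => _; split=> //=.
  have := ps (s.2 p); rewrite /= sub0r nrmN => psp; apply: ltW; apply: psp.
  by elim: p {ps h'2 h'3} => // p IH; exact: leq_ltn_trans IH (ih _ _ _).
pose st := fix st n := if n is n'.+1 then
  let s := st n' in let q := next s in (s.1 + u (s.2 q.1), q.2)
  else (0, id).
have st_incr n : incr (st n).2.
  by elim: n => [//|n IH] /=; have [] := nextP _ IH.
pose m n := (st n).2 (next (st n)).1.
have st_sub n i : exists2 j, ((next (st n)).1 < j)%N & (st n.+1).2 i = (st n).2 j.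
  by have [_ + _ _] := nextP _ (st_incr n); apply.
have mlt n i : (m n < (st n.+1).2 i)%N.
  by have [j ij ->] := st_sub n i; exact: st_incr.
have range_sub n j : range (st (n + j)%N).2 `<=` range (st n).2.
  elim: j => [|j IH]; first by rewrite addn0.
  rewrite addnS => _ [i _ <-]; apply: IH.
  by have [l _ ->] := st_sub (n + j)%N i; exists l.
(* The indices chosen from stage [n] on. *)
pose A n : set nat := [set m (n + j)%N | j in setT].
have A_range n : A n `<=` range (st n).2.
  by move=> _ [j _ <-]; apply: (@range_sub n j); exists (next (st (n + j)%N)).1.
have A_split n : U (A n) = u (m n) + U (A n.+1).
  apply: U_split => i; rewrite /chi; have [->|im] := eqVneq i (m n).
    have An : A n (m n) by exists 0%N; rewrite ?addn0.
    have nAn : ~ A n.+1 (m n).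
      by move=> /A_range[j _] e'; have := mlt n j; rewrite e' ltnn.
    by rewrite (asboolT An) (asboolF nAn) addr0.
  rewrite add0r; congr (nat_of_bool _)%:R; apply: asbool_equiv_eq; split.
    move=> [[|j] _ e']; first by move: im; rewrite -e' addn0 eqxx.
    by exists j => //; rewrite addSnnS.
  by move=> [j _ <-]; exists j.+1 => //; rewrite addSnnS.
have A0 n : U (A 0%N) = (st n).1 + U (A n).
  elim: n => [|n IH]; first by rewrite add0r.
  by rewrite IH A_split addrA.
have mge n : (n <= m n)%N.
  elim: n => // n IH; apply: leq_ltn_trans IH _; exact: mlt.
have [n _ psin] := (cvg_nrmP _ _).1 (psi0 (U (A 0%N))) _ (divr_gt0 e0 (ltr0Sn R 1)).
have := psin (m n) (mge n); apply/negP; rewrite -leNgt sub0r nrmN.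
have [_ _ h1 h2] := nextP _ (st_incr n).
have {}h2 : nrm (psi (m n) (U (A n.+1))) <= e / 4.
  by apply: h2; exact: (@A_range n.+1).
rewrite (A0 n.+1) topdualDr /= topdualDr.
(* The term [u (m n)] contributes at least [e], the earlier and the later ones at most [e / 4] each;
   [e / 2] remains. *)
have := big (m n).
have := ler_nrmB (psi (m n) (u (m n))) (- (psi (m n) (st n).1 + psi (m n) (U (A n.+1)))).
have := nrmD (psi (m n) (st n).1) (psi (m n) (U (A n.+1))).
rewrite opprK nrmN addrCA addrA -/(m n); move: h1; rewrite -/(m n); lra.
Qed.

End phillips.

(** * L-projections and pointwise null sequences *)

Section main.
Context {R : realType} {k : scalar_kind} (X : normedModType (scalars R k)).
Local Notation K := (scalars R k).
Local Notation "r %:K" := (of_real k r) (at level 2, format "r %:K").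

Lemma nrm_half (V : normedModType K) (v : V) : nrm (2^-1%:K *: v) = nrm v / 2.
Proof. by rewrite nrmZ nrm_of_real ger0_norm ?invr_ge0// mulrC. Qed.

Lemma halves (V : lmodType K) (v : V) : 2^-1%:K *: v + 2^-1%:K *: v = v.
Proof.
rewrite -scalerDl -of_realD (_ : 2^-1 + 2^-1 = 1); last by lra.
by rewrite of_real1 scale1r.
Qed.

Lemma nrm_half_sub (a b : K) : nrm (2^-1%:K * b - a) = nrm (b - (a + a)) / 2.
Proof.
rewrite -(nrm_half (b - (a + a) : K^o)) -{1}(halves (a : K^o)).
by rewrite -scalerDr -scalerBr.
Qed.

(** * Extracting a sequence with bounded signed sums *)

Section singular_sequence.
Variables (Q : bidual X -> bidual X) (psi : nat -> bidual X) (F : bidual X).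
Hypothesis LQ : L_proj Q.
Hypothesis psi0 : forall z, (fun n => psi n z) @ \oo --> (0 : K).
Hypothesis QF : forall z c N, c < nrm (F z) ->
  exists2 n, (N <= n)%N & c < nrm (Q (psi n) z).

(* Replacing [y] by the pair [u], [y - u] approximating [Q^* y] and
   [y - Q^* y] does not increase the norms of the signed sums. *)
Let step (e C : R) (y : topdual X) (A : seq (topdual X)) (N : nat) :
  0 < C ->
  (forall a, a \in A -> nrm (a + y) < C /\ nrm (a - y) < C) ->
  e < nrm (F y) -> e < nrm ((F - Q F) y) ->
  exists n u, [/\ (N <= n)%N, e < nrm (psi n u),
    (forall a, a \in [seq a + u | a <- A] ++ [seq a - u | a <- A] ->
      nrm (a + (y - u)) < C /\ nrm (a - (y - u)) < C),
    e < nrm (F (y - u)) & e < nrm ((F - Q F) (y - u))].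
Proof.
move=> C0 Ay Fy Hy; have [lQ QQ _] := LQ.
have [n Nn psiy] := QF N Fy; set H := F - Q F in Hy *.
(* The reflection leaves the value at [H] unchanged, so the lower bound for [H] survives the
   iteration. *)
have QH : Q H = 0.
  have -> : H = -1 *: Q F + F by rewrite scaleN1r addrC.
  by rewrite lQ QQ scaleN1r addNr.
(* Halving the reflection error [d] still leaves all values that must exceed [e] above [e]. *)
pose d := Num.min (nrm (Q (psi n) y) - e) (nrm (H y) - e).
have d0 : 0 < d by rewrite lt_min !subr_gt0 psiy.
have [dpsi dH] : d <= nrm (Q (psi n) y) - e /\ d <= nrm (H y) - e.
  by split; rewrite ge_min lexx ?orbT.
pose phi (j : 'I_3) := nth 0 [:: psi n; F; H] j.
have nthA (i : 'I_(size A)) : A`_i \in A by exact: mem_nth.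
have [||w [wD wB wphi]] := L_proj_reflection
    (a := fun i : 'I_(size A) => A`_i) (y := y) phi LQ C0 d0.
- by move=> i; exact: (Ay _ (nthA i)).1.
- by move=> i; exact: (Ay _ (nthA i)).2.
have {}wD a : a \in A -> nrm (a + w) < C.
  by move=> /(nthP 0)[i iA <-]; exact: (wD (Ordinal iA)).
have {}wB a : a \in A -> nrm (a - w) < C.
  by move=> /(nthP 0)[i iA <-]; exact: (wB (Ordinal iA)).
have w0 : nrm (psi n w - (psi n y - Q (psi n) y *+ 2)) <= d.
  exact: (wphi (Ordinal (isT : 0 < 3)%N)).
have w1 : nrm (F w - (F y - Q F y *+ 2)) <= d.
  exact: (wphi (Ordinal (isT : 1 < 3)%N)).
have w2 : nrm (H w - H y) <= d.
  have := wphi (Ordinal (isT : 2 < 3)%N).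
  by rewrite /phi /= QH topdual0E mul0rn subr0.
(* As [w] stands for [y - 2 Q^* y], [u] stands for [Q^* y] and [y - u] for [(I - Q)^* y]. *)
pose u := 2^-1%:K *: (y - w).
have yu : y - u = 2^-1%:K *: (y + w).
  rewrite -{1}(halves y) /u scalerBr scalerDr opprB addrA addrAC.
  by rewrite addrK addrC.
have uy : u - (y - u) = - w.
  by rewrite yu /u -scalerBr opprD addrACA subrr add0r -opprD scalerN scalerDr halves.
have nrm_half_lt (c x : K) : nrm (x - c) <= d / 2 -> d <= nrm c - e ->
    e < nrm x.
  by have := ler_nrmB (c : K^o) (c - x); rewrite subKr nrmB; lra.
exists n, u; split=> //.
- apply: (@nrm_half_lt (Q (psi n) y)) => //.
  rewrite topdualZr topdualBr nrm_half_sub ler_pM2r ?invr_gt0// nrmB.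
  by rewrite (_ : _ - _ = psi n w - (psi n y - Q (psi n) y *+ 2))// mulr2n; ring.
(* The four combinations [b + u] and [b - u], plus or minus [y - u], equal [b + y], [b - w], [b + w]
   and [b - y]. *)
- move=> a; rewrite mem_cat => /orP[] /mapP[b /[dup] bA /Ay[bD bB] ->].
    have -> : b + u + (y - u) = b + y by rewrite -addrA subrKC.
    have -> : b + u - (y - u) = b - w by rewrite -addrA uy.
    by split=> //; exact: wB.
  have -> : b - u + (y - u) = b + w by rewrite -addrA [- u + _]addrC -opprB uy opprK.
  have -> : b - u - (y - u) = b - y by rewrite -addrA -opprD subrKC.
  by split=> //; exact: wD.
- apply: (@nrm_half_lt (H y)) => //.
  rewrite yu topdualZr topdualDr nrm_half_sub ler_pM2r ?invr_gt0//.
  by rewrite (_ : _ - _ = F w - (F y - Q F y *+ 2))// topdualBE mulr2n; ring.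
- apply: (@nrm_half_lt (H y)) => //.
  rewrite yu topdualZr topdualDr nrm_half_sub ler_pM2r ?invr_gt0//.
  by rewrite (_ : _ - _ = H w - H y)//; ring.
Qed.

Lemma singular_sequence_absurd (z : topdual X) (e : R) : 0 < e ->
  e < nrm (F z) -> e < nrm ((F - Q F) z) -> False.
Proof.
(* The added 1 provides the strict inequality that [step] asks for. *)
move=> e0 Fz Hz; pose C := nrm z + 1.
have C0 : 0 < C by rewrite ltr_pwDr ?nrm_ge0.
(* State: the remainder [y], the list of all signed sums of the elements extracted so far, and a
   lower bound for the next index. *)
pose S := (topdual X * seq (topdual X) * nat)%type.
pose inv (s : S) := [/\ forall a, a \in s.1.2 ->
    nrm (a + s.1.1) < C /\ nrm (a - s.1.1) < C,
  e < nrm (F s.1.1) & e < nrm ((F - Q F) s.1.1)].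
pose upd (s : S) (q : nat * topdual X) : S :=
  (s.1.1 - q.2, [seq a + q.2 | a <- s.1.2] ++ [seq a - q.2 | a <- s.1.2], q.1.+1).
have /choice[next nextP] (s : S) : exists q : nat * topdual X, inv s ->
    [/\ (s.2 <= q.1)%N, e < nrm (psi q.1 q.2) & inv (upd s q)].
  have [[As Fs Hs]|ns] := pselect (inv s); last by exists (0%N, 0).
  by have [n [u [? ? ? ? ?]]] := step s.2 C0 As Fs Hs; exists (n, u).
pose st n := iter n (fun s => upd s (next s)) (z, [:: 0], 0%N).
have st_inv n : inv (st n).
  elim: n => [|n IH]; last by have [] := nextP _ IH.
  split=> //= a; rewrite inE => /eqP ->.
  by rewrite add0r sub0r nrmN ltrDl.
pose u n := (next (st n)).2; pose m n := (next (st n)).1.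
have mge n : (n <= m n)%N.
  have h i : ((st i).2 <= m i)%N by have [] := nextP _ (st_inv i).
  by elim: n => // n IH; apply: leq_trans (h _); rewrite ltnS.
have mem_sum (s : nat -> bool) n :
    \sum_(i < n) (-1) ^+ s i *: u i \in (st n).1.2.
  elim: n => [|n IH]; first by rewrite big_ord0 inE.
  rewrite big_ord_recr /= mem_cat; case: (s n).
    rewrite expr1 scaleN1r; apply/orP; right.
    by apply/mapP; exists (\sum_(i < n) (-1) ^+ s i *: u i).
  rewrite expr0 scale1r; apply/orP; left.
  by apply/mapP; exists (\sum_(i < n) (-1) ^+ s i *: u i).
have uC n (s : nat -> bool) : nrm (\sum_(i < n) (-1) ^+ s i *: u i) <= C.
  have [As _ _] := st_inv n; have [h1 h2] := As _ (mem_sum s n).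
  set a := \sum_(i < n) _ in h1 h2 *; set y := (st n).1.1 in h1 h2.
  (* The signed sum is the mean of [a + y] and [a - y], both controlled by the invariant. *)
  have -> : a = 2^-1%:K *: ((a + y) + (a - y)).
    by rewrite addrACA subrr addr0 scalerDr halves.
  by rewrite nrm_half; have := nrmD (a + y) (a - y); lra.
have [|n] := phillips (psi := psi \o m) uC e0.
  move=> v; apply/cvg_nrmP => d d0.
  have [N _ h] := (cvg_nrmP _ _).1 (psi0 v) d d0.
  by exists N => // n Nn; apply: h; exact: leq_trans (mge n).
apply/negP; rewrite -leNgt ltW//.
by have [] := nextP _ (st_inv n).
Qed.

End singular_sequence.

Lemma L_proj_pointwise_null (Q : bidual X -> bidual X) (psi : nat -> bidual X) :
  L_proj Q -> (forall z, (fun n => psi n z) @ \oo --> (0 : K)) ->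
  forall z, (fun n => Q (psi n) z) @ \oo --> (0 : K).
Proof.
move=> LQ psi0 z0; apply/cvg_nrmP => e e0; apply: contrapT => nlim.
have [N [M psiM]] := topdual_uniform_boundedness psi0.
have QM n : (N <= n)%N -> nrm (Q (psi n)) <= M.
  move=> Nn; have [_ _ nQ] := LQ; apply: le_trans (psiM n Nn).
  by rewrite -(nQ (psi n)) lerDl nrm_ge0.
(* [inf (S z)] is the limsup of [nrm (Q (psi n) z)]. *)
pose S (z : topdual X) : set R :=
  [set c | 0 <= c /\ \forall n \near \oo, nrm (Q (psi n) z) <= c].
have SM z : S z (M * nrm z).
  have M0 : 0 <= M by apply: le_trans (psiM N (leqnn N)); exact: nrm_ge0.
  split; first by rewrite mulr_ge0 ?nrm_ge0.
  exists N => // n /QM h; rewrite (le_trans (nrm_app _ _))//.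
  by rewrite ler_wpM2r ?nrm_ge0.
have sp : seminorm (fun z => inf (S z)).
  apply: inf_seminorm.
  - by move=> z; exists (M * nrm z).
  - by move=> z c [].
  - split=> //; apply: nearW => n; by rewrite linear0 nrm0.
  - move=> y z c d [c0 yc] [d0 zd]; split; first exact: addr_ge0.
    apply: filterS2 yc zd => n yc zd.
    by rewrite topdualDr (le_trans (nrmD _ _))// lerD.
  - move=> a z c [c0 zc]; split; first by rewrite mulr_ge0 ?nrm_ge0.
    apply: filterS zc => n zc.
    by rewrite topdualZr nrmM ler_wpM2l ?nrm_ge0.
have p_le z c : S z c -> inf (S z) <= c.
  by move=> Sc; apply: ge_inf => //; exists 0 => d [].
have [f [lf fp fz0]] := hahn_banach z0 sp.
have [z|F Ff] := @bounded_topdual _ _ _ f M lf.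
  by rewrite (le_trans (fp z))// p_le.
have QF z c m : c < nrm (F z) -> exists2 n, (m <= n)%N & c < nrm (Q (psi n) z).
  move=> cF; apply: contrapT => h.
  have Qc n : (m <= n)%N -> nrm (Q (psi n) z) <= c.
    by move=> mn; rewrite leNgt; apply/negP => ?; apply: h; exists n.
  have : inf (S z) <= c.
    apply: p_le; split; last by exists m.
    by apply: le_trans (Qc m (leqnn m)); exact: nrm_ge0.
  by apply/negP; rewrite -ltNge (lt_le_trans cF)// Ff.
(* A member of [S z0] below [e] would contradict [nlim]. *)
have ep : e <= nrm (F z0).
  rewrite Ff fz0 nrm_of_real (le_trans _ (ler_norm _))//.
  apply: lb_le_inf; first by exists (M * nrm z0).
  move=> c [_ zc]; rewrite leNgt; apply/negP => ce; apply: nlim.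
  by apply: filterS zc => n zc; rewrite sub0r nrmN (le_lt_trans zc).
have e30 : 0 < e / 3 by rewrite divr_gt0.
have Fe3 : e / 3 < nrm (F z0) by lra.
(* If [F - Q F] is small at [z0], then [Q F] is at least [2 e / 3] there, and [I - Q] takes the
   place of [Q]. *)
have [h|h] := ltP (e / 3) (nrm ((F - Q F) z0)).
  exact: singular_sequence_absurd LQ psi0 QF _ _ e30 Fe3 h.
apply: (@singular_sequence_absurd (fun phi => phi - Q phi) psi F
  (L_proj_compl LQ) psi0 _ z0 (e / 3)) => //.
  (* Since [psi n z] tends to 0, passing from [Q] to [I - Q] costs less than [d], half of the
     available gap. *)
  move=> z c m cF; pose d := (nrm (F z) - c) / 2.
  have d0 : 0 < d by rewrite divr_gt0// subr_gt0.
  have [m' _ small] := (cvg_nrmP _ _).1 (psi0 z) d d0.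
  have [|n mn Qn] := QF z (c + d) (maxn m m'); first by rewrite /d; lra.
  exists n; first by rewrite (leq_trans _ mn)// leq_maxl.
  have := small n (leq_trans (leq_maxr _ _) mn); rewrite sub0r nrmN topdualBE.
  by have := ler_nrmB (Q (psi n) z : K^o) (psi n z); rewrite nrmB; lra.
rewrite subKr; have := ler_nrmB (F z0 : K^o) ((F - Q F) z0).
have -> : F z0 - (F - Q F) z0 = Q F z0 by rewrite topdualBE subKr.
lra.
Qed.

End main.

Unset Implicit Arguments.

Theorem theorem0p1 (R : realType) (k : scalar_kind)
    (X : completeNormedModType (scalars R k))
    (P : {linear bidual X -> bidual X}) :
  is_L_projection P ->
  exists2 p : bidual X -> X,
    (forall phi, to_bidual (p phi) = P phi) &
    weak_star_weak_seq_continuous p.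
Proof.
move=> [PP rangeP nP].
have LP : L_proj P.
  split=> // [a f g|phi]; first exact: linearP.
  apply: (can_inj (@of_realK R k)).
  by rewrite of_realD !of_real_nrm nP.
have /choice[p pP] (phi : bidual X) : exists x, to_bidual x = P phi.
  have : range (@to_bidual R k X) (P phi) by rewrite -rangeP; exists phi.
  by move=> [x _ <-]; exists x.
exists p => // u phi /weak_star_cvgP u_phi; apply/weak_cvgP => f.
have psi0 z : (fun n => (u n - phi) z) @ \oo --> (0 : scalars R k).
  apply/cvg_nrmP => e e0; have := (cvg_nrmP _ _).1 (u_phi z) e e0.
  by apply: filterS => n; rewrite sub0r nrmN topdualBE nrmB.
(* Here [Z] is the dual of [X], so the functional [f] is a point of [Z]. *)
have := L_proj_pointwise_null LP psi0 f.
move=> /cvg_nrmP Pf; apply/cvg_nrmP => e e0; apply: filterS (Pf e e0) => n.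
have pE chi : f (p chi) = P chi f by rewrite -pP.
by rewrite !pE linearB sub0r nrmN topdualBE nrmB.
Qed.
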